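(* Let $0<\alpha<2$, $d\in\mathbb N$, and let $p_t$ be the $\alpha$-stable convolution semigroup density on $\mathbb R^d$ described in the context. (i) If $0\le r\le d-\alpha$, $x\in\mathbb R^d$ and $t>0$, then $$\int_{\mathbb R^d}p_t(y-x)\,|y|^{-r}\,dy\le|x|^{-r}.$$ (ii) If $0<r<d-\alpha$, $x\in\mathbb R^d$, $t>0$, $\beta=(d-\alpha-r)/\alpha$, $$q(x)=\frac{2^{\alpha}\,\Gamma\!\left(\frac d2-\frac{\alpha\beta}2\right)\Gamma\!\left(\frac{\alpha(\beta+1)}2\right)}{\Gamma\!\left(\frac d2-\frac{\alpha(\beta+1)}2\right)\Gamma\!\left(\frac{\alpha\beta}2\right)}\,|x|^{-\alpha},$$ and $\tilde p$ is the Schrödinger perturbation of $p$ by $q$, then $$\int_{\mathbb R^d}\tilde p_t(x,y)\,|y|^{-r}\,dy\le|x|^{-r}.$$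
   Context: $g_t(x)=(4\pi t)^{-d/2}e^{-|x|^2/(4t)}$ is the Gaussian kernel on $\mathbb R^d$. For $t>0$, $\eta_t\ge0$ is the density of the $\alpha/2$-stable subordinator at time $t$: $\eta_t(s)=0$ for $s\le0$ and $\int_0^\infty e^{-us}\eta_t(s)\,ds=e^{-tu^{\alpha/2}}$ for $u\ge0$. Put $p_t(x)=\int_0^\infty g_s(x)\eta_t(s)\,ds$ and $p_t(x,y)=p_t(y-x)$. For $q\ge0$, the Schrödinger perturbation of $p$ by $q$ is $\tilde p=\sum_{n=0}^\infty p^{(n)}$, where $p^{(0)}_t(x,y)=p_t(x,y)$ and $$p^{(n)}_t(x,y)=\int_0^t\int_{\mathbb R^d}p_s(x,z)\,q(z)\,p^{(n-1)}_{t-s}(z,y)\,dz\,ds,\qquad n\ge1.$$ Conventions: $|0|^{-r}=\infty$ for $r>0$, and $|x|^{0}=1$. *)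

(* Defs.v *)
From HB Require Import structures.
From mathcomp Require Import all_boot all_order all_algebra.
From mathcomp Require Import all_classical all_reals all_analysis.

Set Implicit Arguments.
Unset Strict Implicit.
Unset Printing Implicit Defensive.
Import Order.TTheory GRing.Theory Num.Theory.
Import numFieldNormedType.Exports.

Local Open Scope classical_set_scope.
Local Open Scope ring_scope.

Section tuple_measure.
Context {d : measure_display} {T : measurableType d} {R : realType}.

Definition tcons n (p : T * n.-tuple T) : n.+1.-tuple T :=
  [tuple of p.1 :: p.2].

Lemma measurable_tcons n : measurable_fun setT (@tcons n).
Proof. exact: measurable_cons measurable_fst measurable_snd. Qed.

Section step.
Variables (mu : {sigma_finite_measure set T -> \bar R}) (n : nat).
Variable nu : {sigma_finite_measure set (n.-tuple T) -> \bar R}.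

Definition tuple_measureS : set (n.+1.-tuple T) -> \bar R :=
  pushforward (mu \x nu)%E (@tcons n).

Let preim (A : set (n.+1.-tuple T)) :
  measurable A -> measurable (@tcons n @^-1` A).
Proof. by move=> mA; rewrite -[X in measurable X]setTI; exact: measurable_tcons. Qed.

Let tuple_measureS0 : tuple_measureS set0 = 0%E.
Proof. by rewrite /tuple_measureS /pushforward preimage_set0 measure0. Qed.

Let tuple_measureS_ge0 A : (0 <= tuple_measureS A)%E.
Proof. exact: (measure_ge0 (mu \x nu)%E). Qed.

Let tuple_measureS_additive : semi_sigma_additive tuple_measureS.
Proof.
move=> F mF tF mUF; rewrite /tuple_measureS /pushforward preimage_bigcup.
apply: measure_semi_sigma_additive => [k|/=|].
- by apply: preim; exact: mF.
- apply/trivIsetP => /= i j _ _ ij; rewrite -preimage_setI.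
  by move/trivIsetP : tF => /(_ _ _ _ _ ij) ->//; rewrite preimage_set0.
- by rewrite -preimage_bigcup; apply: preim.
Qed.

HB.instance Definition _ := isMeasure.Build _ _ _ tuple_measureS
  tuple_measureS0 tuple_measureS_ge0 tuple_measureS_additive.

Let tuple_measureS_sigma_finite : sigma_finite setT tuple_measureS.
Proof.
have [F FT mF] := sigma_finiteT mu.
have [G GT mG] := sigma_finiteT nu.
pose H (k : nat * nat) : set (n.+1.-tuple T) :=
  (fun x => (thead x, [tuple of behead x])) @^-1` (F k.1 `*` G k.2).
have mH k : measurable (H k).
  have mh : measurable_fun setT
      (fun x : n.+1.-tuple T => (thead x, [tuple of behead x])).
    apply: measurable_fun_pair; last exact: measurable_behead.
    exact: measurable_tnth.
  rewrite -[X in measurable X]setTI; apply: mh => //.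
  by apply: measurableX; [exact: (mF _).1|exact: (mG _).1].
have preH k : @tcons n @^-1` H k = F k.1 `*` G k.2.
  have E a (t : n.-tuple T) : [tuple of behead (tcons (a, t))] = t.
    exact: val_inj.
  by apply/seteqP; split=> -[a t]; rewrite /H /preimage /= E theadE.
pose g (k : nat) : nat * nat := odflt (0, 0)%N (unpickle k).
exists (H \o g).
- apply/seteqP; split=> // x _.
  have [i _ Fi] : (\bigcup_i F i) (thead x) by rewrite -FT.
  have [j _ Gj] : (\bigcup_j G j) [tuple of behead x] by rewrite -GT.
  by exists (pickle (i, j)) => //=; rewrite /g pickleK.
- move=> k; split; first exact: mH.
  rewrite /= /tuple_measureS /pushforward preH product_measure1E.
  + by apply: lte_mul_pinfty; rewrite ?measure_ge0 ?ge0_fin_numE ?(mF _).2 ?(mG _).2 ?measure_ge0.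
  + exact: (mF _).1.
  + exact: (mG _).1.
Qed.

HB.instance Definition _ := Measure_isSigmaFinite.Build _ _ _ tuple_measureS
  tuple_measureS_sigma_finite.

End step.

(* n-fold product measure mu \x ... \x mu, transported to tuples *)
Fixpoint tuple_measure (mu : {sigma_finite_measure set T -> \bar R}) n :
    {sigma_finite_measure set (n.-tuple T) -> \bar R} :=
  if n is n'.+1 then tuple_measureS mu (tuple_measure mu n')
  else \d_([tuple] : 0.-tuple T).

End tuple_measure.

Lemma tuple_measure_box d (T : measurableType d) (R : realType)
    (mu : {sigma_finite_measure set T -> \bar R}) n (A : 'I_n -> set T) :
  (forall i, measurable (A i)) ->
  tuple_measure mu n [set x | forall i, A i (tnth x i)] =
  (\prod_(i < n) mu (A i))%E.
Proof.
elim: n A => [|n IH] A mA.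
  rewrite big_ord0 /= diracE mem_set//= => -[] //.
rewrite big_ord_recl /= /tuple_measureS /pushforward.
rewrite [X in product_measure1 _ _ X](_ : _ = A ord0 `*`
    [set x : n.-tuple T | forall i : 'I_n, A (lift ord0 i) (tnth x i)]); last first.
  apply/seteqP; split=> -[a t] /=.
    move=> At; split=> [|i]; first exact: (At ord0).
    by have := At (lift ord0 i); rewrite tnthS.
  move=> [Aa At] i; case: (unliftP ord0 i) => [j|] -> //.
  by rewrite tnthS; exact: At.
rewrite product_measure1E//.
  by congr (_ * _)%E; apply: (IH (fun i => A (lift ord0 i))) => i; exact: mA.
rewrite (_ : mkset _ = \bigcap_(i in [set: 'I_n])
    (fun x : n.-tuple T => tnth x i) @^-1` A (lift ord0 i)); last first.
  by apply/seteqP; split=> x /= Ax i; [move=> _; exact: Ax|exact: Ax].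
apply: fin_bigcap_measurable => // i _.
by rewrite -[X in measurable X]setTI; exact: measurable_tnth.
Qed.

Section euclidean_space.
Context {R : realType} {d : nat}.
Notation Rd := (d.-tuple (measurableTypeR R)).

Definition lebesgue_tuple : {sigma_finite_measure set Rd -> \bar R} :=
  tuple_measure (@lebesgue_measure R) d.

Definition tsub (x y : Rd) : Rd := [tuple tnth x i - tnth y i | i < d].

Definition enorm (x : Rd) : R := Num.sqrt (\sum_(i < d) tnth x i ^+ 2).

(* |x|^{-r}, with |0|^{-r} = +oo for r > 0 and |0|^0 = 1 (as 0 `^ 0 = 1) *)
Definition enorm_powN (x : Rd) (r : R) : \bar R :=
  if (0 < r) && (enorm x == 0) then +oo%E else (enorm x `^ (- r))%:E.

End euclidean_space.

Section kernels.
Context {R : realType} {d : nat}.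
Notation Rd := (d.-tuple (measurableTypeR R)).

Definition gauss_kernel (t : R) (x : Rd) : R :=
  (4 * pi * t) `^ (- (d%:R / 2)) * expR (- (enorm x ^+ 2 / (4 * t))).

(* f is a density of the law at time t of the subordinator with Laplace
   exponent u |-> u `^ (alpha / 2); such an f is unique up to a null set. *)
Record is_stable_subordinator_density (alpha t : R) (f : R -> R) : Prop :=
  IsStableSubordinatorDensity {
    ssd_measurable : measurable_fun setT f ;
    ssd_ge0 : forall s, 0 <= f s ;
    ssd_eq0 : forall s, s <= 0 -> f s = 0 ;
    ssd_laplace : forall u, 0 <= u ->
      (\int[lebesgue_measure]_(s in `]0%R, +oo[) (expR (- (u * s)) * f s)%:E =
        (expR (- (t * u `^ (alpha / 2))))%:E)%E
  }.

Definition subordinated_density (eta : R -> R -> R) (t : R) (x : Rd) : \bar R :=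
  (\int[lebesgue_measure]_(s in `]0%R, +oo[) (gauss_kernel s x * eta t s)%:E)%E.

Definition transition_density (p : R -> Rd -> \bar R) (t : R) (x y : Rd) :
  \bar R := p t (tsub y x).

(* p^(n); the time integral is over the open interval, p_0 being undefined *)
Fixpoint perturbation_term (p : R -> Rd -> Rd -> \bar R) (q : Rd -> \bar R)
    (n : nat) (t : R) (x y : Rd) : \bar R :=
  if n is n'.+1 then
    (\int[lebesgue_measure]_(s in `]0%R, t[) \int[lebesgue_tuple]_z
      (p s x z * q z * perturbation_term p q n' (t - s) z y))%E
  else p t x y.

Definition schrodinger_perturbation (p : R -> Rd -> Rd -> \bar R)
    (q : Rd -> \bar R) (t : R) (x y : Rd) : \bar R :=
  (\sum_(0 <= n <oo) perturbation_term p q n t x y)%E.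

End kernels.

(* Euler's Gamma function; the integral converges for 0 < a. *)
Definition Gamma {R : realType} (a : R) : R :=
  \int[lebesgue_measure]_(x in `]0, +oo[) (x `^ (a - 1) * expR (- x)).

(* Main.v *)
Require Import Defs.
From HB Require Import structures.
From mathcomp Require Import all_boot all_order all_algebra.
From mathcomp Require Import all_classical all_reals all_analysis.
From mathcomp Require Import measurable_realfun.
From mathcomp Require Import ring lra.

Import Order.TTheory GRing.Theory Num.Theory.
Import numFieldNormedType.Exports.
Local Open Scope classical_set_scope.
Local Open Scope ring_scope.

(* Put k_c(s) = (4 pi s)^(-d/2) exp(-c/(4s)), so that g_s(x) = k_{|x|^2}(s).
   Up to constants, |x|^(-r) is the mixture of k_{|x|^2}(w) with the weight
   w^(g-1) dw, g = (d-r)/2, and q(x) |x|^(-r) is the mixture with the weight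
   w^(g'-1) dw, g' = g - alpha/2.  Since Gaussian kernels form a convolution
   semigroup, P_t acts on such mixtures by convolving the mixing measure with
   eta_t.  The balance equation P_t h + int_0^t P_s(q h) ds = h for
   h(x) = |x|^(-r) is thus an identity between measures on the half-line; on the
   side of Laplace transforms it reads, with U = u^(alpha/2),
   e^(-tU) u^(-g) + u^(-g') (1 - e^(-tU)) / U = u^(-g).
   Measures with equal Laplace transforms give the same integral to k_c:
   approximate by Bernstein polynomials in the variable e^(-delta s) and let
   delta tend to 0.  Finally, the balance equation bounds the partial sums of the
   perturbation series by induction: if S_N is the N-th one, then
   S_{N+1} h = P_t h + int_0^t P_s(q S_N h) ds <= P_t h + int_0^t P_s(q h) ds. *)

(** * Bernstein polynomials *)

(** Two obstacles shape the Laplace argument: the measures w^(g-1) dw have infinite mass, and k_0 is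
    unbounded near s = 0. Convolved measures are never formed: a measure on the half-line is given
    by a map [S] and a density [rho] on an arbitrary space, and a convolution by a sum of two maps
    on a product space. The constant in q is forced. If C_r |x|^(-r) denotes the integral of k_c(w)
    w^(g-1) dw with c = |x|^2, the balance requires q(x) |x|^alpha = C_(r+alpha) Gamma(g) / (C_r
    Gamma(g')). The condition r > 0 makes the mixture for |x|^(-r) converge at infinity, and r < d -
    alpha means g' > 0, so that w^(g'-1) is integrable at 0. The cases r = 0, r = d - alpha and x =
    0 are treated apart. *)

Definition bernstein {R : realType} (f : R -> R) (n : nat) : {poly R} :=
  \sum_(k < n.+1) (f (k%:R / n%:R) *+ 'C(n, k))%:P * 'X^k * (1 - 'X) ^+ (n - k).

Definition bernstein_weight {R : realType} (n k : nat) (y : R) : R :=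
  y ^+ k * (1 - y) ^+ (n - k) *+ 'C(n, k).

Lemma horner_bernstein (R : realType) (f : R -> R) n y :
  (bernstein f n).[y] =
  \sum_(k < n.+1) f (k%:R / n%:R) * bernstein_weight n k y.
Proof.
rewrite /bernstein horner_sum; apply: eq_bigr => k _.
by rewrite !hornerE -!mulrA !(mulrnAl, mulrnAr).
Qed.

Section bernstein_moments.
Context {R : realType}.
Implicit Types (n k : nat) (y : R).

Local Notation w := (@bernstein_weight R).

Lemma bernstein_weight_sum n y : \sum_(k < n.+1) w n k y = 1.
Proof.
have := exprDn (1 - y) y n; rewrite subrK expr1n => ->.
by apply: eq_bigr => k _; rewrite /bernstein_weight mulrC.
Qed.

(** Absorption, (k+1) C(n+1,k+1) = (n+1) C(n,k): each factor k lowers a binomial moment to one for n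
    - 1. *)
Let weightS n k y : w n.+1 k.+1 y *+ k.+1 = (n.+1%:R * y) * w n k y.
Proof.
rewrite /bernstein_weight subSS -mulrnA mulnC -mul_bin_diag mulnC mulrnA exprS.
by ring.
Qed.

Lemma bernstein_mean n y : \sum_(k < n.+1) w n k y *+ k = n%:R * y.
Proof.
case: n => [|n]; first by rewrite big_ord_recl big_ord0 /= mulr0n addr0 mul0r.
rewrite big_ord_recl /= mulr0n add0r.
under eq_bigr do rewrite weightS.
by rewrite -mulr_sumr bernstein_weight_sum mulr1.
Qed.

Lemma bernstein_moment2 n y :
  \sum_(k < n.+1) w n k y * (k%:R - n%:R * y) ^+ 2 = n%:R * y * (1 - y).
Proof.
(* The raw second moment of the binomial law; absorbing one factor k leaves a mean and a total
   mass. *)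
have H : \sum_(k < n.+1) w n k y *+ k *+ k = n%:R * y * ((n%:R - 1) * y + 1).
  case: n => [|n]; first by rewrite big_ord_recl big_ord0 /= mulr0n addr0 !mul0r.
  rewrite big_ord_recl /= mulr0n add0r.
  rewrite (eq_bigr (fun k : 'I_n.+1 => n.+1%:R * y * (w n k y *+ k + w n k y)));
    last first.
    by move=> k _; rewrite /bump add1n weightS -mulrnAr (mulrSr (w n k y)).
  rewrite -mulr_sumr big_split /= bernstein_mean bernstein_weight_sum.
  by congr (_ * (_ * _ + _)); rewrite -natr1 addrK.
rewrite (eq_bigr (fun k : 'I_n.+1 => w n k y *+ k *+ k
   - (2 * n%:R * y) * (w n k y *+ k) + (n%:R * y) ^+ 2 * w n k y)).
  rewrite big_split sumrB /= -!mulr_sumr H bernstein_mean bernstein_weight_sum.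
  by ring.
by move=> k _; ring.
Qed.

Lemma bernstein_weight_ge0 n k y : 0 <= y <= 1 -> 0 <= w n k y.
Proof.
move=> /andP[y0 y1]; rewrite /bernstein_weight mulrn_wge0// mulr_ge0// exprn_ge0//.
by rewrite subr_ge0.
Qed.

Lemma bernstein_bound (f : R -> R) (M : R) n y : 0 <= y <= 1 ->
  (forall u, `|f u| <= M) -> `|(bernstein f n).[y]| <= M.
Proof.
move=> y01 fM; rewrite horner_bernstein (le_trans (ler_norm_sum _ _ _))//.
have -> : M = \sum_(k < n.+1) M * w n k y.
  by rewrite -mulr_sumr bernstein_weight_sum mulr1.
apply: ler_sum => k _.
by rewrite normrM (ger0_norm (bernstein_weight_ge0 _ _ _ y01)) ler_wpM2r//
  bernstein_weight_ge0.
Qed.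

(** Bernstein's argument by Chebyshev's inequality. Continuity is asked at [y] alone, since the
    function it serves, phi(-ln y / delta), is controlled only for 0 < y < 1. *)
Lemma bernstein_cvg (f : R -> R) (M : R) y : 0 <= y <= 1 ->
  (forall u, `|f u| <= M) -> {for y, continuous f} ->
  (bernstein f n).[y] @[n --> \oo] --> f y.
Proof.
move=> y01 fM cf; have M0 : 0 <= M by rewrite (le_trans _ (fM 0)).
apply/cvgrPdist_lt => e e0.
have e20 : 0 < e / 2 by rewrite divr_gt0.
have /cvgrPdist_lt/(_ _ e20) [d /= d0 fd] := cf.
have : (2 * M / d ^+ 2 * n.+1%:R^-1 : R) @[n --> \oo] --> (2 * M / d ^+ 2 * 0 : R).
  by apply: cvgMr; exact: cvg_harmonic.
rewrite mulr0 => /cvgrPdist_lt/(_ _ e20) H.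
near=> n.
have n0 : (0 < n)%N by near: n; exists 1.
have n0R : 0 < n%:R :> R by rewrite ltr0n.
have w0 k : 0 <= w n k y by exact: bernstein_weight_ge0.
have C0 : 0 <= 2 * M / d ^+ 2.
  by rewrite divr_ge0 ?exprn_ge0 ?mulr_ge0//; exact: ltW.
(* Near [y] continuity gives e/2; away from it (k/n - y)^2 / d^2 is at least 1, so the trivial bound
   2M may be multiplied by it. Summed against the weights, the last term becomes a variance. *)
have key (k : 'I_n.+1) : `|f y - f (k%:R / n%:R)| <=
    e / 2 + 2 * M / d ^+ 2 / n%:R ^+ 2 * (k%:R - n%:R * y) ^+ 2.
  have [yk|yk] := ltP `|y - k%:R / n%:R| d.
    rewrite (le_trans (ltW (fd _ yk)))// lerDl mulr_ge0 ?sqr_ge0//.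
    by rewrite divr_ge0// exprn_ge0//; exact: ltW.
  rewrite (@le_trans _ _ (2 * M))//.
    by rewrite (le_trans (ler_normB _ _))// mulr2n mulrDl mul1r lerD.
  apply: ler_wpDl; first exact: ltW.
  rewrite [leRHS](_ : _ = 2 * M * ((y - k%:R / n%:R) ^+ 2 / d ^+ 2)); last first.
    by field; rewrite !gt_eqF.
  rewrite ler_peMr ?mulr_ge0// ler_pdivlMr ?exprn_gt0// mul1r.
  by rewrite -[leRHS]real_normK ?num_real// lerXn2r// nnegrE ltW.
rewrite horner_bernstein.
have -> : f y = \sum_(k < n.+1) f y * w n k y.
  by rewrite -mulr_sumr bernstein_weight_sum mulr1.
rewrite -sumrB.
rewrite (le_lt_trans (ler_norm_sum _ _ _))//.
apply: (@le_lt_trans _ _ (\sum_(k < n.+1) (e / 2 * w n k y +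
   2 * M / d ^+ 2 / n%:R ^+ 2 * (w n k y * (k%:R - n%:R * y) ^+ 2)))).
  apply: ler_sum => k _; rewrite -mulrBl normrM (ger0_norm (w0 k)).
  rewrite (mulrC (w n k y) (_ ^+ 2)) mulrA -mulrDl ler_wpM2r//.
rewrite big_split /= -!mulr_sumr bernstein_weight_sum bernstein_moment2 mulr1.
rewrite [ltRHS]splitr ltrD2l.
apply: (@le_lt_trans _ _ (2 * M / d ^+ 2 * n%:R^-1)).
  rewrite -mulrA ler_wpM2l//.
  rewrite expr2 invfM -!mulrA mulKf ?gt_eqF// ler_piMr ?invr_ge0//.
  by case/andP: y01 => y0 y1; rewrite mulr_ile1 ?subr_ge0// gerBl.
near: n; case: H => N _ H; exists N.+1 => // -[//|m] /= Nm.
by have := H m Nm; rewrite sub0r normrN; exact: le_lt_trans (ler_norm _).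
Unshelve. all: by end_near. Qed.

End bernstein_moments.

(** * Laplace transforms *)

(** Reduction to real powers: the power -1 is the inverse on nonnegative numbers, hence the detour
    through the square. *)
Lemma measurable_funV {d} {T : measurableType d} {R : realType} (f : T -> R) :
  measurable_fun setT f -> measurable_fun setT (fun x => (f x)^-1).
Proof.
move=> mf; rewrite (_ : (fun x => _) = (fun x => f x * (f x ^+ 2) `^ (-1))).
  apply: measurable_funM => //.
  by apply: (measurableT_comp (measurable_powR _)); exact: measurable_funX.
apply/funext => x; rewrite powR_inv1 ?sqr_ge0//.
have [->|fx0] := eqVneq (f x) 0; first by rewrite invr0 mul0r.
by rewrite expr2 invfM mulVKf.
Qed.

(* [L] is the Laplace transform of the image under [S] of the measure with
   density [rho] with respect to [mu]; the image is carried by ]0, +oo[. *)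
Record is_laplace {d} {X : measurableType d} {R : realType}
    (mu : {measure set X -> \bar R}) (S rho : X -> R) (L : R -> R) : Prop :=
  IsLaplace {
    laplace_measurable : measurable_fun setT S ;
    laplace_weight_measurable : measurable_fun setT rho ;
    laplace_weight_ge0 : forall x, 0 <= rho x ;
    laplace_pos : forall x, rho x != 0 -> 0 < S x ;
    laplaceE : forall u, 0 < u ->
      (\int[mu]_x (expR (- (u * S x)) * rho x)%:E = (L u)%:E)%E
  }.

Section laplace.
Context {d} {X : measurableType d} {R : realType}.
Variables (mu : {measure set X -> \bar R}) (S rho : X -> R) (L : R -> R).
Hypothesis LS : is_laplace mu S rho L.

Let mS := laplace_measurable _ _ _ _ LS.
Let mrho := laplace_weight_measurable _ _ _ _ LS.
Let rho0 := laplace_weight_ge0 _ _ _ _ LS.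

Lemma measurable_laplace u :
  measurable_fun setT (fun x => expR (- (u * S x)) * rho x).
Proof.
apply: measurable_funM => //; apply: measurableT_comp => //.
by apply: measurable_funN; apply: measurable_funM.
Qed.

Lemma integrable_laplace u : 0 < u ->
  mu.-integrable setT (fun x => (expR (- (u * S x)) * rho x)%:E).
Proof.
move=> u0; apply/integrableP; split.
  by apply/measurable_EFinP; exact: measurable_laplace.
under eq_integral do rewrite gee0_abs ?lee_fin ?mulr_ge0 ?expR_ge0//.
by rewrite (laplaceE _ _ _ _ LS)// ltry.
Qed.

(** With y = e^(-delta s), the function y b_n(y) is a combination of the exponentials e^(-delta
    (i+1) s), so its integral involves only values of [L]. The extra factor y gives an integrable
    majorant although the total mass may be infinite. *)
Lemma laplace_cvg (phi : R -> R) (M delta : R) : 0 < delta ->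
  measurable_fun setT phi -> (forall s, `|phi s| <= M) ->
  (forall s, 0 < s -> {for s, continuous phi}) ->
  let b := bernstein (fun y => phi (- ln y / delta)) in
  (\sum_(i < size (b n)) (b n)`_i * L (delta * i.+1%:R))%:E @[n --> \oo] -->
  (\int[mu]_x (expR (- (delta * S x)) * phi (S x) * rho x)%:E)%E.
Proof.
move=> d0 mphi phiM cphi b.
have d0' : delta != 0 by rewrite gt_eqF.
pose y x := expR (- (delta * S x)).
have y01 x : rho x != 0 -> 0 <= y x <= 1.
  move=> /(laplace_pos _ _ _ _ LS) Sx.
  by rewrite expR_ge0 expR_le1 oppr_le0 mulr_ge0// ltW.
pose F n x := (y x * (b n).[y x] * rho x)%:E.
have FE n x : F n x = (\sum_(i < size (b n)) ((b n)`_i)%:E *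
    (expR (- (delta * i.+1%:R * S x)) * rho x)%:E)%E.
  rewrite /F horner_coef mulr_sumr mulr_suml -sumEFin; apply: eq_bigr => i _.
  rewrite -EFinM; congr EFin; rewrite (_ : - (_ * _ * _) = i.+1%:R * - (delta * S x)).
    by rewrite expRM_natl exprS -/(y x); ring.
  by ring.
have FI n : (\int[mu]_x F n x =
    (\sum_(i < size (b n)) (b n)`_i * L (delta * i.+1%:R))%:E)%E.
  under eq_integral do rewrite FE.
  rewrite integral_sum//; last first.
    move=> i; apply: integrableZl => //; apply: integrable_laplace.
    by rewrite mulr_gt0// ltr0n.
  rewrite -sumEFin; apply: eq_bigr => i _.
  rewrite integralZl//; last first.
    by apply: integrable_laplace; rewrite mulr_gt0// ltr0n.
  by rewrite (laplaceE _ _ _ _ LS) ?mulr_gt0 ?ltr0n// EFinM.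
under eq_cvg do rewrite -FI.
have mF n : measurable_fun setT (F n).
  apply: (eq_measurable_fun (fun x => \sum_(i < size (b n)) ((b n)`_i)%:E *
    (expR (- (delta * i.+1%:R * S x)) * rho x)%:E)%E) => [x _|]; first by rewrite FE.
  apply: emeasurable_sum => i; apply: measurable_funeM.
  by apply/measurable_EFinP; exact: measurable_laplace.
have [] // := @dominated_convergence _ _ _ mu _ measurableT F
  (fun x => (y x * phi (S x) * rho x)%:E)
  (fun x => M%:E * (expR (- (delta * S x)) * rho x)%:E)%E mF.
- apply/measurable_EFinP; rewrite (_ : (fun x => _) =
    (fun x => (expR (- (delta * S x)) * rho x) * (phi \o S) x)); last first.
    by apply/funext => x; rewrite mulrAC.
  apply: measurable_funM; first exact: measurable_laplace.
  exact: measurableT_comp.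
- apply: aeW => x _; have [r0|r0] := eqVneq (rho x) 0.
    rewrite r0 mulr0 (_ : F^~ x = cst 0%E); first exact: cvg_cst.
    by apply/funext => n; rewrite /F r0 mulr0.
  apply: cvg_EFin; first exact: nearW.
  apply: cvgMl; apply: cvgMr.
  (* The substitution s = -ln y / delta carries the half-line to ]0, 1[, where Bernstein polynomials
     apply. *)
  rewrite (_ : phi (S x) = (fun y => phi (- ln y / delta)) (y x)); last first.
    by rewrite /= expRK opprK mulrC mulKf.
  apply: (@bernstein_cvg _ _ M); [exact: y01|by move=> u; exact: phiM|].
  apply: (@continuous_comp _ _ _ (fun y => - ln y / delta) phi).
    apply: continuousM; last exact: cst_continuous.
    by apply: continuousN; apply: continuous_ln; exact: expR_gt0.
  rewrite /= expRK opprK [_ / _]mulrC mulKf//.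
  by apply: cphi; exact: (laplace_pos _ _ _ _ LS).
- by apply: integrableZl => //; exact: integrable_laplace.
- apply: aeW => x n _; have [r0|r0] := eqVneq (rho x) 0.
    by rewrite /F r0 !mulr0 abse0 mule0.
  rewrite /F lee_fin normrM normrM (ger0_norm (rho0 x)) ger0_norm ?expR_ge0//.
  rewrite -/(y x) mulrA ler_wpM2r// mulrC ler_wpM2r ?expR_ge0//.
  by apply: bernstein_bound; [exact: y01|move=> u; exact: phiM].
Qed.

End laplace.

(** Raise x/b <= e^(x/b) to the power b. The sharp constant has a further factor e^(-b). *)
Lemma powR_expRN_le {R : realType} (x b : R) : 0 <= x -> 0 < b ->
  x `^ b * expR (- x) <= b `^ b.
Proof.
move=> x0 b0; rewrite expRN ler_pdivrMr ?expR_gt0//.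
have -> : x `^ b = b `^ b * (x / b) `^ b.
  by rewrite -powRM ?divr_ge0 ?(ltW b0)// mulrC divfK// gt_eqF.
have -> : expR x = expR (x / b) `^ b by rewrite -expRM divfK// gt_eqF.
rewrite ler_wpM2l ?powR_ge0// ge0_ler_powR ?nnegrE ?divr_ge0 ?expR_ge0 ?(ltW b0)//.
by rewrite (le_trans _ (expR_ge1Dx _))// lerDr.
Qed.

(** The function k_c of the overview, at time [s]; [c] stands for |x|^2. *)
Definition heat {R : realType} (d : nat) (s c : R) : R :=
  (4 * pi * s) `^ (- (d%:R / 2)) * expR (- (c / (4 * s))).

(** * The heat kernel as a function of time *)

Section heat.
Context {R : realType} (d : nat).
Implicit Types s c : R.
Local Notation heat := (@heat R d).

Lemma heat_ge0 s c : 0 <= heat s c.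
Proof. by rewrite mulr_ge0 ?powR_ge0 ?expR_ge0. Qed.

(** With v = c/(4s) the kernel is a constant times v^(d/2) e^(-v); this needs c > 0. *)
Lemma heat_bound c : (0 < d)%N -> 0 < c ->
  exists M, forall s, `|heat `|s| c| <= M.
Proof.
move=> d0 c0; have d20 : 0 < d%:R / 2 :> R by rewrite divr_gt0 ?ltr0n.
exists ((pi * c) `^ (- (d%:R / 2)) * (d%:R / 2) `^ (d%:R / 2)) => s.
have pic : 0 < pi * c by rewrite mulr_gt0// pi_gt0.
rewrite ger0_norm ?heat_ge0//; have := normr_ge0 s.
rewrite le_eqVlt => /predU1P[<-|].
  (* At time 0 the power has base 0 and a nonzero exponent, hence the value 0 by convention; here d
     > 0 matters. *)
  by rewrite /heat mulr0 powR0 ?mul0r ?mulr_ge0 ?powR_ge0// oppr_eq0 gt_eqF.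
move: `|s| => {}s s0.
pose v := c / (4 * s); have v0 : 0 < v by rewrite divr_gt0// mulr_gt0.
have -> : heat s c = (pi * c) `^ (- (d%:R / 2)) * (v `^ (d%:R / 2) * expR (- v)).
  rewrite /heat -/v mulrA; congr (_ * _).
  have -> : 4 * pi * s = pi * c / v by rewrite /v; field; rewrite !gt_eqF.
  rewrite powRM ?invr_ge0 ?ltW//; congr (_ * _).
  by rewrite -powR_inv1 ?ltW// -powRrM mulN1r opprK.
by rewrite ler_wpM2l ?powR_ge0// powR_expRN_le// ltW.
Qed.

Lemma heat_continuous c s : 0 < s -> {for s, continuous (fun s => heat `|s| c)}.
Proof.
move=> s0; apply: (@continuous_comp _ _ _ (@Num.norm R R) (fun s => heat s c)).
  exact: norm_continuous.
rewrite gtr0_norm//; apply: continuousM.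
  apply: (@continuous_comp _ _ _ (fun s => 4 * pi * s) (@powR R ^~ _)).
    by apply: continuousM => //; exact: cst_continuous.
  apply: differentiable_continuous; apply/derivable1_diffP.
  by apply: derivable_powR; rewrite in_itv/= andbT !mulr_gt0// pi_gt0.
apply: continuous_comp; last exact: continuous_expR.
apply: continuousN; apply: continuousM; first exact: cst_continuous.
apply: continuousV; first by rewrite gt_eqF// mulr_gt0.
by apply: continuousM => //; exact: cst_continuous.
Qed.

Lemma measurable_heat d' (T : measurableType d') (f g : T -> R) :
  measurable_fun setT f -> measurable_fun setT g ->
  measurable_fun setT (fun x => heat (f x) (g x)).
Proof.
move=> mf mg; apply: measurable_funM.
  by apply: (measurableT_comp (measurable_powR _)); exact: measurable_funM.
apply: measurableT_comp => //; apply: measurable_funN.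
apply: measurable_funM => //; apply: measurable_funV.
exact: measurable_funM.
Qed.

(** The exponential factor compensates for infinite mass, the shift of [c] for the singularity of
    the kernel when c = 0. Monotonicity lets both be removed at once by monotone convergence. *)
Lemma heat_approx_nd c s : 0 <= s -> 0 <= c ->
  nondecreasing_seq
    (fun n => expR (- (n.+1%:R^-1 * s)) * heat s (c + n.+1%:R^-1)).
Proof.
move=> s0 c0 m n mn.
have nm : n.+1%:R^-1 <= m.+1%:R^-1 :> R by rewrite lef_pV2 ?posrE ?ltr0n// ler_nat.
rewrite ler_pM ?expR_ge0 ?heat_ge0//.
  by rewrite ler_expR lerN2 ler_wpM2r.
rewrite ler_wpM2l ?powR_ge0// ler_expR lerN2 ler_wpM2r ?invr_ge0 ?mulr_ge0//.
by rewrite lerD2l.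
Qed.

Lemma heat_approx_cvg c s :
  expR (- (n.+1%:R^-1 * s)) * heat s (c + n.+1%:R^-1) @[n --> \oo] --> heat s c.
Proof.
have h : (n.+1%:R^-1 : R) @[n --> \oo] --> (0 : R) by exact: cvg_harmonic.
rewrite -[X in _ --> X]mul1r; apply: cvgM.
  rewrite -[X in _ --> X]expR0; apply: continuous_cvg; first exact: continuous_expR.
  rewrite -[X in _ --> X]oppr0 -[X in _ --> - X](mul0r s).
  by apply: cvgN; apply: cvgM h _; exact: cvg_cst.
apply: cvgM; first exact: cvg_cst.
apply: continuous_cvg; first exact: continuous_expR.
apply: cvgN; apply: cvgM; last exact: cvg_cst.
by rewrite -[X in _ --> X]addr0; apply: cvgD h; exact: cvg_cst.
Qed.

End heat.

(** * From Laplace transforms to integrals of the heat kernel *)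

Section heat_laplace.
Context {R : realType} (dim : nat) (dim_gt0 : (0 < dim)%N).
Local Notation heat := (@heat R dim).

(* [`|s|] only serves to make the function bounded on the whole line. *)
Let approx_phi (c : R) (m : nat) (s : R) := heat `|s| (c + m.+1%:R^-1).

Let approx_b (c : R) (m n : nat) :=
  bernstein (fun y => approx_phi c m (- ln y / m.+1%:R^-1)) n.

Let approx_sum (c : R) (m n : nat) (L : R -> R) :=
  \sum_(i < size (approx_b c m n))
    (approx_b c m n)`_i * L (m.+1%:R^-1 * i.+1%:R).

Let approx_int {d} {X : measurableType d} (mu : {measure set X -> \bar R})
    (S rho : X -> R) (c : R) m :=
  (\int[mu]_x (expR (- (m.+1%:R^-1 * S x)) * approx_phi c m (S x) * rho x)%:E)%E.

Lemma heat_laplace_cvg {d} {X : measurableType d}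
    (mu : {measure set X -> \bar R}) (S rho : X -> R) (L : R -> R) (c : R) m :
  is_laplace mu S rho L -> 0 <= c ->
  (approx_sum c m n L)%:E @[n --> \oo] --> approx_int mu S rho c m.
Proof.
move=> LS c0; have cm0 : 0 < c + m.+1%:R^-1 by rewrite ltr_wpDl.
have [M hM] := heat_bound dim _ dim_gt0 cm0.
apply: (laplace_cvg _ _ _ _ LS _ M) => //.
- by apply: measurable_heat => //; exact: normr_measurable.
- by move=> s s0; exact: heat_continuous.
Qed.

Lemma heat_approx_int_cvg {d} {X : measurableType d}
    (mu : {measure set X -> \bar R}) (S rho : X -> R) (L : R -> R) (c : R) :
  is_laplace mu S rho L -> 0 <= c ->
  approx_int mu S rho c m @[m --> \oo] -->
  (\int[mu]_x (heat (S x) c * rho x)%:E)%E.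
Proof.
move=> LS c0.
have mS := laplace_measurable _ _ _ _ LS.
have mrho := laplace_weight_measurable _ _ _ _ LS.
have rho0 := laplace_weight_ge0 _ _ _ _ LS.
have Spos x : rho x != 0 -> `|S x| = S x.
  by move=> /(laplace_pos _ _ _ _ LS) /gtr0_norm.
have E m x : expR (- (m.+1%:R^-1 * S x)) * approx_phi c m (S x) * rho x =
    expR (- (m.+1%:R^-1 * `|S x|)) * heat `|S x| (c + m.+1%:R^-1) * rho x.
  by have [->|/Spos r0] := eqVneq (rho x) 0; rewrite ?mulr0// /approx_phi r0.
rewrite [X in _ --> X](_ : _ = \int[mu]_x
   limn (fun m => (expR (- (m.+1%:R^-1 * S x)) * approx_phi c m (S x) * rho x)%:E))%E.
  apply: cvg_monotone_convergence => //.
  - move=> m; apply/measurable_EFinP; apply: measurable_funM => //.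
    apply: measurable_funM.
      apply: measurableT_comp => //; apply: measurable_funN.
      by apply: measurable_funM.
    apply: measurable_heat => //; apply: measurableT_comp mS.
    exact: normr_measurable.
  - by move=> m x _; rewrite lee_fin mulr_ge0// mulr_ge0 ?expR_ge0// heat_ge0.
  - move=> x _ m n mn; rewrite lee_fin (E m) (E n) ler_wpM2r//.
    exact: (@heat_approx_nd R dim c `|S x| (normr_ge0 _) c0 m n mn).
apply: eq_integral => x _; apply/esym/cvg_lim => //.
apply: cvg_EFin; first exact: nearW.
rewrite [X in X @ _](_ : _ = fun m =>
    expR (- (m.+1%:R^-1 * `|S x|)) * heat `|S x| (c + m.+1%:R^-1) * rho x); last first.
  by apply/funext => m; rewrite /= E.
have [r0|/Spos r0] := eqVneq (rho x) 0.
  rewrite r0 mulr0 [X in X @ _](_ : _ = cst 0); first exact: cvg_cst.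
  by apply/funext => m; rewrite mulr0.
by apply: cvgMl; rewrite r0; exact: heat_approx_cvg.
Qed.

(** The numbers [approx_sum] depend linearly on the transform, with coefficients common to all three
    measures. A relation between transforms thus survives both limits. It is kept as a sum because
    the integrals may be infinite. *)
Lemma heat_laplace_add {d1 d2 d3} {X1 : measurableType d1}
    {X2 : measurableType d2} {X3 : measurableType d3}
    (mu1 : {measure set X1 -> \bar R}) (mu2 : {measure set X2 -> \bar R})
    (mu3 : {measure set X3 -> \bar R}) (S1 rho1 : X1 -> R) (S2 rho2 : X2 -> R)
    (S3 rho3 : X3 -> R) (L1 L2 L3 : R -> R) (c : R) :
  is_laplace mu1 S1 rho1 L1 -> is_laplace mu2 S2 rho2 L2 ->
  is_laplace mu3 S3 rho3 L3 ->
  (forall u, 0 < u -> L1 u + L2 u = L3 u) -> 0 <= c ->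
  (\int[mu1]_x (heat (S1 x) c * rho1 x)%:E +
   \int[mu2]_x (heat (S2 x) c * rho2 x)%:E =
   \int[mu3]_x (heat (S3 x) c * rho3 x)%:E)%E.
Proof.
move=> H1 H2 H3 L123 c0.
have pos d (X : measurableType d) (mu : {measure set X -> \bar R}) S rho L :
    is_laplace mu S rho L -> forall m, (0 <= approx_int mu S rho c m)%E.
  move=> LS m; apply: integral_ge0 => x _; rewrite lee_fin mulr_ge0//.
    by rewrite mulr_ge0 ?expR_ge0// heat_ge0.
  exact: laplace_weight_ge0 LS _.
have step m : (approx_int mu1 S1 rho1 c m + approx_int mu2 S2 rho2 c m =
               approx_int mu3 S3 rho3 c m)%E.
  have LE n : approx_sum c m n L3 = approx_sum c m n L1 + approx_sum c m n L2.
    rewrite -big_split/=; apply: eq_bigr => i _.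
    by rewrite -mulrDr L123// mulr_gt0// ltr0n.
  rewrite -(cvg_lim _ (heat_laplace_cvg _ _ _ _ c m H3 c0))//.
  under eq_fun do rewrite LE EFinD.
  apply/esym/cvg_lim => //.
  apply: cvgeD; [|exact: heat_laplace_cvg H1 c0|exact: heat_laplace_cvg H2 c0].
  apply: ge0_adde_def; rewrite inE; first exact: (pos _ _ _ _ _ _ H1).
  exact: (pos _ _ _ _ _ _ H2).
rewrite -(cvg_lim _ (heat_approx_int_cvg _ _ _ _ c H3 c0))//.
under [in RHS]eq_fun do rewrite -step.
apply/esym/cvg_lim => //.
apply: cvgeD; [|exact: heat_approx_int_cvg H1 c0|exact: heat_approx_int_cvg H2 c0].
have lim0 d (X : measurableType d) (mu : {measure set X -> \bar R}) S rho L :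
    is_laplace mu S rho L -> (0 <= \int[mu]_x (heat (S x) c * rho x)%:E)%E.
  move=> LS; apply: integral_ge0 => x _; rewrite lee_fin mulr_ge0 ?heat_ge0//.
  exact: laplace_weight_ge0 LS _.
apply: ge0_adde_def; rewrite inE; first exact: (lim0 _ _ _ _ _ _ H1).
exact: (lim0 _ _ _ _ _ _ H2).
Qed.

Lemma heat_laplace_unique {d1 d2} {X1 : measurableType d1}
    {X2 : measurableType d2}
    (mu1 : {measure set X1 -> \bar R}) (mu2 : {measure set X2 -> \bar R})
    (S1 rho1 : X1 -> R) (S2 rho2 : X2 -> R) (L : R -> R) (c : R) :
  is_laplace mu1 S1 rho1 L -> is_laplace mu2 S2 rho2 L -> 0 <= c ->
  (\int[mu1]_x (heat (S1 x) c * rho1 x)%:E =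
   \int[mu2]_x (heat (S2 x) c * rho2 x)%:E)%E.
Proof.
move=> H1 H2 c0.
(* Uniqueness is additivity with a zero density as first summand. *)
have H0 : is_laplace mu1 S1 (cst 0) (cst 0).
  split => //; first exact: laplace_measurable H1.
    by move=> x; rewrite eqxx.
  by move=> u u0; rewrite integral0_eq// => x _; rewrite mulr0.
rewrite -(heat_laplace_add _ _ _ _ _ _ _ _ _ _ _ _ c H0 H1 H2)//.
  by rewrite [X in (X + _)%E]integral0_eq ?add0e// => x _; rewrite mulr0.
by move=> u _; rewrite add0r.
Qed.

End heat_laplace.

(** * The Gamma function *)

Section half_line_substitution.
Context {R : realType}.
Implicit Types (G : R -> R) (c : R).
Local Notation mu := (@lebesgue_measure R).

(** This exhaustion is adapted to inversion: x -> c/x maps [1/(n+1), n+1] onto [c/(n+1), c(n+1)]. *)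
Lemma half_line_bigcup c : 0 < c ->
  \bigcup_n `[c / n.+1%:R, c * n.+1%:R]%classic = `]0, +oo[%classic.
Proof.
move=> c0; apply/seteqP; split=> x /=.
  move=> [n _]; rewrite /= !in_itv/= andbT => /andP[+ _]; apply: lt_le_trans.
  by rewrite divr_gt0// ltr0n.
rewrite in_itv/= andbT => x0.
have [n hn] : exists n, Num.max (c / x) (x / c) < n.+1%:R.
  exists (Num.bound (Num.max (c / x) (x / c))).
  rewrite (lt_trans (archi_boundP _)) ?ltr_nat//.
  by apply: ltW; rewrite lt_max divr_gt0.
exists n => //=; move: hn; rewrite gt_max => /andP[h1 h2].
rewrite in_itv/=; apply/andP; split.
  by rewrite ler_pdivrMr ?ltr0n// mulrC -ler_pdivrMr// ltW.
by rewrite mulrC -ler_pdivrMr// ltW.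
Qed.

Lemma half_line_itv_pos c n x : 0 < c -> x \in `[c / n.+1%:R, c * n.+1%:R] -> 0 < x.
Proof.
by move=> c0; rewrite in_itv/= => /andP[+ _]; apply: lt_le_trans; rewrite divr_gt0.
Qed.

Lemma half_line_within G c n : (forall x, 0 < x -> {for x, continuous G}) -> 0 < c ->
  {within `[c / n.+1%:R, c * n.+1%:R], continuous G}.
Proof.
move=> cG c0; apply: continuous_in_subspaceT => x; rewrite inE/= => hx.
by apply: cG; exact: half_line_itv_pos hx.
Qed.

Lemma half_line_cvg G c : (forall x, 0 < x -> {for x, continuous G}) ->
  (forall x, 0 < x -> 0 <= G x) -> 0 < c ->
  (\int[mu]_(x in `[(c / n.+1%:R)%R, (c * n.+1%:R)%R]) (G x)%:E)%E @[n --> \oo] -->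
  (\int[mu]_(x in `]0%R, +oo[) (G x)%:E)%E.
Proof.
move=> cG G0 c0; rewrite -(half_line_bigcup c)//.
apply: ge0_nondecreasing_set_cvg_integral => //.
- move=> m n mn; apply/subsetPset; apply: subset_itv.
    rewrite bnd_simp ler_wpM2l ?(ltW c0)//.
    by rewrite lef_pV2 ?posrE ?ltr0n// ler_nat.
  by rewrite bnd_simp ler_wpM2l ?(ltW c0)// ler_nat.
- move=> n; apply/measurable_EFinP; apply: subspace_continuous_measurable_fun => //.
  exact: half_line_within.
- by move=> n x hx; rewrite lee_fin G0//; exact: half_line_itv_pos hx.
Qed.

Let F c (w : R) := c / w.

Let dF c (x : R) : 0 < x -> is_derive x 1 (F c) (- (c / x ^+ 2)).
Proof.
move=> x0; have := @is_deriveV R id x 1 1 (lt0r_neq0 x0) _.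
move=> /(_ (is_derive_id _ _)) h.
have := @is_deriveZ _ _ _ _ c _ _ _ h.
by move=> H; apply: (is_derive_eq H); rewrite /GRing.scale/= mulr1 mulrN.
Qed.

Let F1 c (x : R) : 0 < x -> derive1 (F c) x = - (c / x ^+ 2).
Proof. by move=> x0; rewrite derive1E; have [_ ->] := dF c _ x0. Qed.

Let F1_cvg c (x : R) : 0 < x -> derive1 (F c) y @[y --> x] --> - (c / x ^+ 2).
Proof.
move=> x0; apply: cvg_trans.
  apply: near_eq_cvg; near=> y; symmetry; apply: F1.
  near: y; exact: lt_nbhsr.
apply: cvgN; apply: cvgM; first exact: cvg_cst.
apply: cvgV; first by rewrite sqrf_eq0 gt_eqF.
exact: exprn_continuous.
Unshelve. all: by end_near. Qed.

Let F_cvg c (x : R) : 0 < x -> F c y @[y --> x] --> F c x.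
Proof.
move=> x0; apply: cvgM; first exact: cvg_cst.
by apply: cvgV; [rewrite gt_eqF|exact: cvg_id].
Qed.

Lemma half_line_inv G c : (forall x, 0 < x -> {for x, continuous G}) ->
  (forall x, 0 < x -> 0 <= G x) -> 0 < c ->
  (\int[mu]_(x in `]0%R, +oo[) (G x)%:E =
   \int[mu]_(x in `]0%R, +oo[) (G (c / x) * (c / x ^+ 2))%:E)%E.
Proof.
move=> cG G0 c0.
pose H x := G (c / x) * (c / x ^+ 2).
have cH x : 0 < x -> {for x, continuous H}.
  move=> x0; apply: continuousM.
    apply: (@continuous_comp _ _ _ (F c) G); first exact: F_cvg.
    by apply: cG; rewrite divr_gt0.
  apply: cvgM; first exact: cvg_cst.
  apply: cvgV; first by rewrite sqrf_eq0 gt_eqF.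
  exact: exprn_continuous.
have H0 x : 0 < x -> 0 <= H x.
  by move=> x0; rewrite mulr_ge0 ?G0 ?divr_gt0 ?divr_ge0 ?exprn_ge0// ltW.
(* The exhaustion is taken around c for [G] and around 1 for [H], so that the compact integrals
   correspond term by term. *)
rewrite -(cvg_lim _ (half_line_cvg _ _ cG G0 c0))//.
rewrite -(cvg_lim _ (half_line_cvg _ _ cH H0 ltr01))//.
congr (limn _); apply/funext => n.
have n0 : 0 < n.+1%:R :> R by rewrite ltr0n.
have ab : 1 / n.+1%:R <= 1 * n.+1%:R :> R.
  by rewrite div1r mul1r (@le_trans _ _ 1)// ?invf_le1// ler1n.
have a0 : 0 < 1 / n.+1%:R :> R by rewrite divr_gt0.
have -> : c / n.+1%:R = F c (1 * n.+1%:R) by rewrite /F mul1r.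
have -> : c * n.+1%:R = F c (1 / n.+1%:R) by rewrite /F invf_div divr1.
rewrite integration_by_substitution_decreasing//.
- apply: eq_integral => x; rewrite inE/= => /(half_line_itv_pos _ _ _ ltr01) x0.
  rewrite [((_ \o _) * _) x](_ : _ = G (c / x) * - derive1 (F c) x)//.
  by rewrite F1// opprK.
- move=> x y /(half_line_itv_pos _ _ _ ltr01) x0.
  move=> /(half_line_itv_pos _ _ _ ltr01) y0 xy.
  by rewrite ltr_pM2l// ltf_pV2.
- move=> x; rewrite in_itv/= => /andP[ax _]; have x0 := lt_trans a0 ax.
  by rewrite /continuous_at F1//; exact: F1_cvg.
- by apply/cvg_ex; eexists; apply: cvg_at_right_filter; exact: F1_cvg.
- apply/cvg_ex; eexists; apply: cvg_at_left_filter; apply: F1_cvg.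
  by rewrite mul1r.
- split.
  + move=> x; rewrite in_itv/= => /andP[ax _]; have x0 := lt_trans a0 ax.
    by have [] := dF c _ x0.
  + by apply: cvg_at_right_filter; exact: F_cvg.
  + by apply: cvg_at_left_filter; apply: F_cvg; rewrite mul1r.
- have -> : F c (1 * n.+1%:R) = c / n.+1%:R by rewrite /F mul1r.
  have -> : F c (1 / n.+1%:R) = c * n.+1%:R by rewrite /F invf_div divr1.
  exact: half_line_within.
Qed.

(** Scaling is the composition of the inversions x -> c/x and x -> 1/x. *)
Lemma half_line_scale G c : (forall x, 0 < x -> {for x, continuous G}) ->
  (forall x, 0 < x -> 0 <= G x) -> 0 < c ->
  (\int[mu]_(x in `]0%R, +oo[) (G x)%:E =
   \int[mu]_(x in `]0%R, +oo[) (G (c * x) * c)%:E)%E.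
Proof.
move=> cG G0 c0; rewrite (half_line_inv _ _ cG G0 c0).
rewrite (@half_line_inv (fun x => G (c / x) * (c / x ^+ 2)) 1)//.
- apply: eq_integral => x; rewrite inE/= in_itv/= andbT => x0; congr EFin.
  have x0' : x != 0 by rewrite gt_eqF.
  rewrite [c / _](_ : _ = c * x); last by field.
  by rewrite -mulrA; congr (_ * _); field.
- move=> x x0; apply: continuousM.
    apply: (@continuous_comp _ _ _ (F c) G); first exact: F_cvg.
    by apply: cG; rewrite divr_gt0.
  apply: cvgM; first exact: cvg_cst.
  apply: cvgV; first by rewrite sqrf_eq0 gt_eqF.
  exact: exprn_continuous.
- by move=> x x0; rewrite mulr_ge0 ?G0 ?divr_gt0 ?divr_ge0 ?exprn_ge0// ltW.
Qed.

End half_line_substitution.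

(** * Convergence of Euler's integral and integrals of Gamma type *)

Section Gamma.
Context {R : realType}.
Implicit Types (a u c : R).
Local Notation mu := (@lebesgue_measure R).

Let f a (x : R) := x `^ (a - 1) * expR (- x).

Let powR_continuous a (x : R) : 0 < x -> {for x, continuous (@powR R ^~ a)}.
Proof.
move=> x0; apply: differentiable_continuous; apply/derivable1_diffP.
by apply: derivable_powR; rewrite in_itv/= andbT.
Qed.

Let f_continuous a (x : R) : 0 < x -> {for x, continuous (f a)}.
Proof.
move=> x0; apply: continuousM; first exact: powR_continuous.
by apply: continuous_comp; [exact: continuousN|exact: continuous_expR].
Qed.

Let f_ge0 a x : 0 <= f a x.
Proof. by rewrite mulr_ge0 ?powR_ge0 ?expR_ge0. Qed.

(* The derivative of [a^-1 * (x / (1 + x)) `^ a]; it dominates [f a]. *)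
Let g a (x : R) := (1 - (1 + x)^-1) `^ (a - 1) * (1 + x) ^- 2.

Let g_ge0 a x : 0 <= g a x.
Proof. by rewrite mulr_ge0 ?powR_ge0 ?invr_ge0 ?sqr_ge0. Qed.

Let base_gt0 (x : R) : 0 < x -> 0 < 1 - (1 + x)^-1.
Proof. by move=> x0; rewrite subr_gt0 invf_lt1 ?ltrDl// addr_gt0. Qed.

Let g_continuous a (z : R) : 0 < z -> {for z, continuous (g a)}.
Proof.
move=> z0; have z10 : 0 < 1 + z by rewrite addr_gt0.
have c1 : {for z, continuous (fun x : R => 1 + x)}.
  by apply: cvgD; [exact: cvg_cst|exact: cvg_id].
apply: continuousM.
  apply: (@continuous_comp _ _ _ (fun x : R => 1 - (1 + x)^-1) (@powR R ^~ _)).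
    apply: cvgB; first exact: cvg_cst.
    by apply: cvgV; [rewrite gt_eqF|exact: c1].
  by apply: powR_continuous; exact: base_gt0.
apply: cvgV; first by rewrite sqrf_eq0 gt_eqF.
apply: (@continuous_comp _ _ _ (fun x : R => 1 + x) (fun x => x ^+ 2)) => //.
exact: exprn_continuous.
Qed.

(** The quotient of the two functions is (1+x)^(a+1) e^(-x), that is, e times y^(a+1) e^(-y) at y =
    1 + x, to which [powR_expRN_le] applies. *)
Let f_le_g a x : 0 < a -> 0 < x -> f a x <= (expR 1 * (a + 1) `^ (a + 1)) * g a x.
Proof.
move=> a0 x0; have x10 : 0 < 1 + x by rewrite addr_gt0.
have -> : f a x = (1 - (1 + x)^-1) `^ (a - 1) * ((1 + x) `^ (a - 1) * expR (- x)).
  rewrite /f mulrA -powRM ?(ltW (base_gt0 _ x0)) ?(ltW x10)//.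
  congr (_ `^ _ * _); rewrite mulrBl mul1r mulVf ?gt_eqF//; ring.
rewrite /g [leRHS]mulrCA ler_wpM2l ?powR_ge0//.
rewrite ler_pdivlMr ?exprn_gt0// mulrAC -powR_mulrn ?(ltW x10)// -powRD; last first.
  by rewrite (lt0r_neq0 x10) implybT.
have -> : a - 1 + 2 = a + 1 by ring.
rewrite (_ : - x = 1 + - (1 + x)); last by ring.
rewrite expRD mulrCA ler_wpM2l ?expR_ge0// powR_expRN_le ?ltW// addr_gt0//.
Qed.

Let G a (x : R) := a^-1 * (1 - (1 + x)^-1) `^ a.

Let dG a (x : R) : 0 < a -> 0 < x -> is_derive x 1 (G a) (g a x).
Proof.
move=> a0 x0; have x10 : 0 < 1 + x by rewrite addr_gt0.
have h0 : is_derive x 1 (fun x : R => 1 + x) 1.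
  have := @is_deriveD R R R (cst (1 : R)) (id : R -> R) x 1 0 1
    (is_derive_cst _ _ _) (is_derive_id _ _).
  by move=> H; apply: (is_derive_eq H); rewrite add0r.
have h1 := @is_deriveV R _ x 1 1 (lt0r_neq0 x10) h0.
have h2 : is_derive x 1 (fun x : R => 1 - (1 + x)^-1) ((1 + x) ^- 2).
  have := @is_deriveB R R R (cst (1 : R)) _ x 1 0 _ (is_derive_cst _ _ _) h1.
  move=> H; apply: (is_derive_eq H).
  by rewrite sub0r /GRing.scale/= mulr1 opprK.
have h3 : is_derive (1 - (1 + x)^-1) 1 (@powR R ^~ a)
    (a * (1 - (1 + x)^-1) `^ (a - 1)).
  have xin : 1 - (1 + x)^-1 \in `]0, +oo[ by rewrite in_itv/= andbT base_gt0.
  apply: DeriveDef; first exact: derivable_powR.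
  by rewrite -derive1E powR_derive1.
have h4 := @is_derive1_comp R (@powR R ^~ a) (fun x : R => 1 - (1 + x)^-1) x _ _ h3 h2.
have := @is_deriveZ _ _ _ _ a^-1 _ _ _ h4.
move=> H; apply: (is_derive_eq H).
by rewrite /g /GRing.scale/= !mulrA mulVf ?gt_eqF// mul1r.
Qed.

Let g_int a (x y : R) : 0 < a -> 0 < x -> x < y ->
  (\int[mu]_(z in `[x, y]) (g a z)%:E <= (a^-1)%:E)%E.
Proof.
move=> a0 x0 xy.
have pos z : x <= z -> 0 < z by apply: lt_le_trans.
have Gc (z : R) : 0 < z -> G a w @[w --> z] --> G a z.
  move=> z0; apply: differentiable_continuous; apply/derivable1_diffP.
  by have [] := dG _ _ a0 z0.
rewrite (@continuous_FTC2 _ (g a) (G a))//.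
- rewrite -EFinB lee_fin (@le_trans _ _ (G a y))//.
    by rewrite gerBl mulr_ge0 ?powR_ge0// invr_ge0 ltW.
  rewrite ler_piMr ?invr_ge0 ?(ltW a0)//.
  have y0 : 0 < y by exact: lt_trans xy.
  rewrite -[leRHS](powRr0 (1 - (1 + y)^-1)) ger_powR// ?(ltW a0)// base_gt0//.
  by rewrite gerBl invr_ge0 addr_ge0// ltW.
- apply: continuous_in_subspaceT => z; rewrite inE/= in_itv/= => /andP[/pos z0 _].
  exact: g_continuous.
- split.
  + by move=> z; rewrite in_itv/= => /andP[/ltW/pos z0 _]; have [] := dG _ _ a0 z0.
  + by apply: cvg_at_right_filter; exact: Gc.
  + by apply: cvg_at_left_filter; apply: Gc; exact: lt_trans xy.
- move=> z; rewrite in_itv/= => /andP[/ltW/pos z0 _].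
  by rewrite derive1E; have [_ ->] := dG _ _ a0 z0.
Qed.

(** [Gamma] is the real part of an extended integral and would be 0 for an infinite one, so
    finiteness is the point. The primitive of [g], with values between 0 and a^-1, handles both ends
    of the half-line at once. *)
Lemma GammaE a : 0 < a ->
  (\int[mu]_(x in `]0%R, +oo[) (x `^ (a - 1) * expR (- x))%:E)%E = (Gamma a)%:E.
Proof.
move=> a0; rewrite /Gamma /Rintegral fineK// ge0_fin_numE; last first.
  by apply: integral_ge0 => x _; rewrite lee_fin; exact: f_ge0.
set C := expR 1 * (a + 1) `^ (a + 1).
have C0 : 0 <= C by rewrite mulr_ge0 ?expR_ge0 ?powR_ge0.
apply: (@le_lt_trans _ _ (C * a^-1)%:E); last exact: ltry.
have cf := @half_line_cvg R (f a) 1 (f_continuous a) (fun x _ => f_ge0 a x) ltr01.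
rewrite -(cvg_lim _ cf)//; apply: lime_le; first by apply/cvg_ex; eexists; exact: cf.
(* The first interval of the exhaustion is the point 1, to which the estimate of [g_int] does not
   apply. *)
apply: nearW => -[|n].
  rewrite invr1 mulr1 set_itv1 integral_set1 lee_fin mulr_ge0// invr_ge0 ltW//.
have n0 : 0 < 1 / n.+2%:R :> R by rewrite divr_gt0.
have nn : 1 / n.+2%:R < 1 * n.+2%:R :> R.
  by rewrite div1r mul1r (@lt_trans _ _ 1) ?invf_lt1 ?ltr1n.
rewrite EFinM (le_trans _ (lee_wpmul2l _ (g_int a _ _ a0 n0 nn))) ?lee_fin//.
have mg : measurable_fun setT (g a).
  apply: measurable_funM.
    apply: (measurableT_comp (measurable_powR _)); apply: measurable_funB => //.
    by apply: measurable_funV; exact: measurable_funD.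
  by apply: measurable_funV; apply: measurable_funX; exact: measurable_funD.
rewrite -ge0_integralZl_EFin//; last 2 first.
- by move=> x _; rewrite lee_fin.
- by apply/measurable_EFinP; exact: measurable_funTS.
apply: ge0_le_integral => //.
- by move=> x _; rewrite lee_fin.
- apply/measurable_EFinP; apply: subspace_continuous_measurable_fun => //.
  by apply: half_line_within => //; exact: f_continuous.
- by apply/measurable_EFinP; apply: measurable_funTS; exact: measurable_funM.
- move=> x /(half_line_itv_pos _ _ _ ltr01) x0.
  by rewrite lee_fin; exact: f_le_g.
Qed.

Lemma Gamma_gt0 a : 0 < a -> 0 < Gamma a.
Proof.
move=> a0; rewrite -lte_fin -GammaE//.
(* On [1, 2] one has x^(a-1) >= 1/x >= 1/2, because a > 0, and e^(-x) >= e^(-2). *)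
apply: (@lt_le_trans _ _ (\int[mu]_(x in `[1%R, 2%R]) (expR (- 2) / 2)%:E)%E).
  rewrite (integral_cst mu)//.
  rewrite /= lebesgue_measure_itv/= lte_fin ltr1n/= -EFinB -EFinM.
  by rewrite lte_fin mulr_gt0 ?divr_gt0 ?expR_gt0//; lra.
have mf (D : set R) : measurable_fun D (EFin \o f a).
  apply/measurable_EFinP; apply: measurable_funTS; apply: measurable_funM.
    exact: measurable_powR.
  by apply: measurableT_comp => //; exact: measurable_funN.
have sub : [set` `[1 : R, 2 : R]] `<=` [set` `]0 : R, +oo[].
  by move=> x /=; rewrite !in_itv/= andbT => /andP[+ _]; exact: lt_le_trans.
apply: (@le_trans _ _ (\int[mu]_(x in `[1%R, 2%R]) (f a x)%:E)%E); last first.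
  by apply: ge0_subset_integral => //; [apply: mf|move=> x _; rewrite lee_fin].
apply: ge0_le_integral => //.
  exact: mf.
move=> x /=; rewrite in_itv/= => /andP[x1 x2]; rewrite lee_fin /f.
have x0 : 0 < x by exact: lt_le_trans x1.
rewrite mulrC ler_pM ?invr_ge0 ?expR_ge0 ?ler_expR ?lerN2//.
rewrite (@le_trans _ _ x^-1) ?lef_pV2 ?posrE//.
rewrite powRB ?(gt_eqF x0) ?implybT// powRr1 ?(ltW x0)//.
rewrite ler_peMl ?invr_ge0 ?(ltW x0)//.
by rewrite -[leLHS](powRr0 x) ler_powR// ltW.
Qed.

Lemma gamma_laplace a u : 0 < a -> 0 < u ->
  (\int[mu]_(x in `]0%R, +oo[) (x `^ (a - 1) * expR (- (u * x)))%:E =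
  (u `^ (- a) * Gamma a)%:E)%E.
Proof.
move=> a0 u0; rewrite EFinM -GammaE// (half_line_scale (f a) u)//; last exact: f_continuous.
have mh : measurable_fun setT (fun x => x `^ (a - 1) * expR (- (u * x))).
  apply: measurable_funM; first exact: measurable_powR.
  by apply: measurableT_comp => //; apply: measurable_funN; exact: measurable_funM.
rewrite -ge0_integralZl_EFin ?powR_ge0//; last 2 first.
- by move=> x _; rewrite lee_fin mulr_ge0 ?f_ge0 ?ltW.
- apply/measurable_EFinP; apply: measurable_funTS.
  apply: measurable_funM => //; apply: measurable_funM.
    by apply: (measurableT_comp (measurable_powR _)); exact: measurable_funM.
  by apply: measurableT_comp => //; apply: measurable_funN; exact: measurable_funM.
apply: eq_integral => x; rewrite inE/= in_itv/= andbT => x0.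
rewrite -EFinM; congr EFin; rewrite /f powRM ?ltW// powRN.
have -> : u `^ (a - 1) = u `^ a / u.
  by rewrite powRB ?(gt_eqF u0) ?implybT// powRr1 ?ltW.
by field; rewrite !gt_eqF ?powR_gt0.
Qed.

Lemma gamma_inverse a c : 0 < a -> 0 < c ->
  (\int[mu]_(x in `]0%R, +oo[) (x `^ (- a - 1) * expR (- (c / x)))%:E =
  (c `^ (- a) * Gamma a)%:E)%E.
Proof.
move=> a0 c0; rewrite EFinM -GammaE// (half_line_inv (f a) c)//; last exact: f_continuous.
rewrite -ge0_integralZl_EFin ?powR_ge0//; last 2 first.
- by move=> x _; rewrite lee_fin mulr_ge0 ?f_ge0 ?mulr_ge0 ?invr_ge0 ?sqr_ge0 ?ltW.
- apply/measurable_EFinP; apply: measurable_funTS.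
  have mcV : measurable_fun setT (fun x : R => c / x).
    by apply: measurable_funM => //; exact: measurable_funV.
  apply: measurable_funM; last first.
    by apply: measurable_funM => //; apply: measurable_funV.
  apply: measurable_funM; first exact: (measurableT_comp (measurable_powR _)).
  by apply: measurableT_comp => //; exact: measurable_funN.
apply: eq_integral => x; rewrite inE/= in_itv/= andbT => x0.
rewrite -EFinM; congr EFin; rewrite /f powRM ?invr_ge0 ?ltW//.
have -> : x^-1 `^ (a - 1) = x `^ (- a - 1) * x ^+ 2.
  rewrite -powR_inv1 ?(ltW x0)// -powRrM -powR_mulrn ?(ltW x0)//.
  rewrite -powRD ?(gt_eqF x0) ?implybT//.
  by congr (_ `^ _); ring.
have -> : c `^ (a - 1) = c `^ a / c.
  by rewrite powRB ?(gt_eqF c0) ?implybT// powRr1 ?ltW.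
by rewrite (powRN c); field; rewrite !gt_eqF ?powR_gt0.
Qed.

(** Up to the factor (4 pi)^(-d/2) this is [gamma_inverse] with exponent d/2 - b and parameter
    c/4. *)
Lemma heat_riesz (d : nat) (b c : R) : 0 < d%:R / 2 - b -> 0 < c ->
  (\int[mu]_(w in `]0%R, +oo[) (heat d w c * w `^ (b - 1))%:E =
  ((4 * pi) `^ (- (d%:R / 2)) * (c / 4) `^ (- (d%:R / 2 - b)) *
    Gamma (d%:R / 2 - b))%:E)%E.
Proof.
move=> a0 c0; rewrite -mulrA EFinM -gamma_inverse ?divr_gt0//.
rewrite -ge0_integralZl_EFin ?powR_ge0//; last 2 first.
- by move=> x _; rewrite lee_fin mulr_ge0 ?powR_ge0 ?expR_ge0.
- apply/measurable_EFinP; apply: measurable_funTS.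
  apply: measurable_funM; first exact: measurable_powR.
  apply: measurableT_comp => //; apply: measurable_funN.
  by apply: measurable_funM => //; exact: measurable_funV.
apply: eq_integral => x; rewrite inE/= in_itv/= andbT => x0.
rewrite -EFinM; congr EFin; rewrite /heat powRM ?mulr_ge0 ?pi_ge0 ?(ltW x0)//.
rewrite (_ : - (c / 4 / x) = - (c / (4 * x))); last by field; rewrite gt_eqF.
have -> : x `^ (- (d%:R / 2 - b) - 1) = x `^ (- (d%:R / 2)) * x `^ (b - 1).
  by rewrite -powRD ?(gt_eqF x0) ?implybT//; congr (_ `^ _); ring.
by ring.
Qed.

End Gamma.

(** * Gaussian kernels *)

Section tuple_integral.
Context {d : measure_display} {T : measurableType d} {R : realType}.
Variable mu : {sigma_finite_measure set T -> \bar R}.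

Lemma ge0_integral_tupleS n (F : n.+1.-tuple T -> \bar R) :
  measurable_fun setT F -> (forall x, (0 <= F x)%E) ->
  (\int[tuple_measure mu n.+1]_x F x =
   \int[mu]_a \int[tuple_measure mu n]_t F (tcons (a, t)))%E.
Proof.
move=> mF F0.
rewrite (eq_measure_integral (pushforward (mu \x tuple_measure mu n)%E (@tcons _ _ n)))//.
  exact: measurable_tcons.
move=> mt; rewrite ge0_integral_pushforward//.
rewrite preimage_setT fubini_tonelli1//; first exact: measurableT_comp.
by move=> x; exact: F0.
Qed.

Lemma integral_tuple_prod n (f : 'I_n -> T -> R) (c : 'I_n -> R) :
  (forall i, measurable_fun setT (f i)) -> (forall i x, 0 <= f i x) ->
  (forall i, (\int[mu]_x (f i x)%:E = (c i)%:E)%E) ->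
  (\int[tuple_measure mu n]_y (\prod_(i < n) f i (tnth y i))%:E =
   (\prod_(i < n) c i)%:E)%E.
Proof.
elim: n f c => [|n IH] f c mf f0 fc.
  under eq_integral do rewrite big_ord0.
  by rewrite big_ord0 (integral_cst (tuple_measure mu 0))// mul1e /= diracT.
rewrite ge0_integral_tupleS; last 2 first.
- apply/measurable_EFinP; apply: measurable_prod => i _.
  by apply: measurableT_comp => //; exact: measurable_tnth.
- by move=> x; rewrite lee_fin prodr_ge0.
transitivity (\int[mu]_a ((f ord0 a)%:E * (\prod_(i < n) c (lift ord0 i))%:E))%E.
  apply: eq_integral => a _.
  rewrite -(IH (fun i => f (lift ord0 i)) (fun i => c (lift ord0 i)))//.
  rewrite -ge0_integralZl_EFin//; last 2 first.
  - by move=> x _; rewrite lee_fin prodr_ge0.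
  - apply/measurable_EFinP; apply: measurable_prod => i _.
    by apply: measurableT_comp => //; exact: measurable_tnth.
  apply: eq_integral => t _; rewrite big_ord_recl -EFinM; congr (_ * _)%:E.
  by apply: eq_bigr => i _; rewrite tnthS.
under eq_integral do rewrite muleC.
have c0 i : 0 <= c i by rewrite -lee_fin -fc integral_ge0// => x _; rewrite lee_fin.
rewrite ge0_integralZl_EFin ?prodr_ge0//.
- by rewrite fc big_ord_recl -EFinM mulrC.
- by move=> x _; rewrite lee_fin.
- exact/measurable_EFinP.
Qed.

End tuple_integral.

Section gauss1.
Context {R : realType}.
Implicit Types s w x y m : R.
Local Notation mu := (@lebesgue_measure R).

(** The centred normal density of variance 2s. *)
Definition gauss1 s x : R := (4 * pi * s) `^ (- 2^-1) * expR (- (x ^+ 2 / (4 * s))).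

Lemma gauss1_ge0 s x : 0 <= gauss1 s x.
Proof. by rewrite mulr_ge0 ?powR_ge0 ?expR_ge0. Qed.

Lemma measurable_gauss1 s m : measurable_fun setT (fun x => gauss1 s (x - m)).
Proof.
apply: measurable_funM => //; apply: measurableT_comp => //.
apply: measurable_funN; apply: measurable_funM => //; apply: measurable_funX.
exact: measurable_funB.
Qed.

Lemma integral_gauss1 s m : 0 < s -> (\int[mu]_x (gauss1 s (x - m))%:E = 1)%E.
Proof.
move=> s0; have s20 : 0 < 2 * s by rewrite mulr_gt0.
have sq0 : Num.sqrt (2 * s) != 0 by rewrite sqrtr_eq0 -ltNge.
rewrite -[RHS](integral_normal_pdf m (Num.sqrt (2 * s))); apply: eq_integral => x _; congr EFin.
rewrite normal_pdfE// /gauss1 /normal_peak /normal_fun sqr_sqrtr ?(ltW s20)//.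
congr (_ * expR _).
  rewrite powRN powR12_sqrt; last by rewrite !mulr_ge0 ?pi_ge0 ?ltW.
  by congr (Num.sqrt _)^-1; ring.
by rewrite mulNr; congr (- (_ / _)); ring.
Qed.

(** Completing the square in [y]. The second factor on the right is a normal density in [y], so the
    convolution formula follows from its total mass 1. *)
Lemma gauss1M s w x y : 0 < s -> 0 < w ->
  gauss1 s (y - x) * gauss1 w y =
  gauss1 (s + w) x * gauss1 (s * w / (s + w)) (y - x * w / (s + w)).
Proof.
move=> s0 w0; have sw0 : 0 < s + w by rewrite addr_gt0.
have pos (z : R) : 0 < z -> 0 <= 4 * pi * z.
  by move=> z0; rewrite !mulr_ge0 ?pi_ge0 ?ltW.
have v0 : 0 < s * w / (s + w) by rewrite divr_gt0// mulr_gt0.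
rewrite /gauss1 [LHS]mulrACA [RHS]mulrACA -expRD -[in RHS]expRD.
rewrite -(powRM _ (pos _ s0) (pos _ w0)) -(powRM _ (pos _ sw0) (pos _ v0)).
by congr (_ `^ _ * expR _); field; rewrite !gt_eqF.
Qed.

Lemma gauss1_conv s w x : 0 < s -> 0 < w ->
  (\int[mu]_y (gauss1 s (y - x) * gauss1 w y)%:E = (gauss1 (s + w) x)%:E)%E.
Proof.
move=> s0 w0.
under eq_integral do rewrite gauss1M// EFinM.
rewrite ge0_integralZl_EFin ?gauss1_ge0//.
- by rewrite integral_gauss1 ?mule1// divr_gt0 ?mulr_gt0 ?addr_gt0.
- by move=> y _; rewrite lee_fin gauss1_ge0.
- by apply/measurable_EFinP; exact: measurable_gauss1.
Qed.

End gauss1.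

Section gauss.
Context {R : realType} {d : nat}.
Local Notation Rd := (d.-tuple (measurableTypeR R)).
Local Notation leb := (@lebesgue_tuple R d).
Implicit Types (s w : R) (x y : Rd).

Lemma gauss_kernelE s x : gauss_kernel s x = heat d s (enorm x ^+ 2).
Proof. by []. Qed.

Lemma sqr_enorm x : enorm x ^+ 2 = \sum_(i < d) tnth x i ^+ 2.
Proof. by rewrite sqr_sqrtr// sumr_ge0// => i _; rewrite sqr_ge0. Qed.

Lemma gauss_kernel_prod s x : gauss_kernel s x = \prod_(i < d) gauss1 s (tnth x i).
Proof.
rewrite /gauss_kernel /gauss1 big_split /= prodr_const card_ord sqr_enorm.
rewrite mulr_suml -sumrN expR_sum; congr (_ * _).
by rewrite -powR_mulrn ?powR_ge0// -powRrM; congr (_ `^ _); field.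
Qed.

Lemma gauss_kernel_ge0 s x : 0 <= gauss_kernel s x.
Proof. exact: heat_ge0. Qed.

Lemma integral_gauss s x : 0 < s -> (\int[leb]_y (gauss_kernel s (tsub y x))%:E = 1)%E.
Proof.
move=> s0; under eq_integral do rewrite gauss_kernel_prod.
have := @integral_tuple_prod _ _ _ (@lebesgue_measure R) d
  (fun i z => gauss1 s (z - tnth x i)) (fun=> 1).
rewrite big1// => <- //.
- by apply: eq_integral => y _; congr EFin; apply: eq_bigr => i _; rewrite tnth_mktuple.
- by move=> i; exact: measurable_gauss1.
- by move=> i z; exact: gauss1_ge0.
- by move=> i; exact: integral_gauss1.
Qed.

Lemma gauss_conv s w x : 0 < s -> 0 < w ->
  (\int[leb]_y (gauss_kernel s (tsub y x) * gauss_kernel w y)%:E =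
   (gauss_kernel (s + w) x)%:E)%E.
Proof.
move=> s0 w0; rewrite gauss_kernel_prod.
under eq_integral do rewrite !gauss_kernel_prod -big_split/=.
rewrite -(@integral_tuple_prod _ _ _ (@lebesgue_measure R) d
  (fun i z => gauss1 s (z - tnth x i) * gauss1 w z))//.
- by apply: eq_integral => y _; congr EFin; apply: eq_bigr => i _; rewrite tnth_mktuple.
- move=> i; apply: measurable_funM; first exact: measurable_gauss1.
  by have := @measurable_gauss1 R w 0; under eq_fun do rewrite subr0.
- by move=> i z; rewrite mulr_ge0// gauss1_ge0.
- by move=> i; exact: gauss1_conv.
Qed.

Lemma enorm_eq0 x : (enorm x == 0) = [forall i, tnth x i == 0].
Proof.
have s0 : 0 <= \sum_(i < d) tnth x i ^+ 2 by rewrite sumr_ge0// => i _; rewrite sqr_ge0.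
rewrite -sqrf_eq0 sqr_enorm psumr_eq0; last by move=> i _; rewrite sqr_ge0.
apply/allP/forallP => h i.
  by have := h i (mem_index_enum _); rewrite sqrf_eq0.
by move=> _; rewrite sqrf_eq0; exact: h.
Qed.

(** Under the integral sign |y|^(-r) can then be replaced by its mixture, which is established off
    the origin. *)
Lemma enorm_eq0_null : (0 < d)%N -> leb [set y | enorm y = 0] = 0%E.
Proof.
move=> d0; rewrite (_ : [set y | _] = [set y : Rd | forall i, [set 0] (tnth y i)]).
  rewrite (@tuple_measure_box _ (measurableTypeR R) R (@lebesgue_measure R) d
    (fun=> [set (0 : R)]))//.
  by rewrite (bigD1 (Ordinal d0))//= lebesgue_measure_set1 mul0e.
apply/seteqP; split => y /=.
  by move=> /eqP; rewrite enorm_eq0 => /forallP h i; exact/eqP.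
by move=> h; apply/eqP; rewrite enorm_eq0; apply/forallP => i; apply/eqP.
Qed.

Lemma enorm_ge0 x : 0 <= enorm x. Proof. exact: sqrtr_ge0. Qed.

Lemma measurable_enorm d' (T : measurableType d') (f : T -> Rd) :
  measurable_fun setT f -> measurable_fun setT (fun z => enorm (f z)).
Proof.
move=> mf; rewrite (_ : (fun z => _) =
    fun z => (\sum_(i < d) tnth (f z) i ^+ 2) `^ 2^-1); last first.
  apply/funext => z; rewrite powR12_sqrt// sumr_ge0// => i _.
  exact: sqr_ge0.
apply: (measurableT_comp (measurable_powR _)).
apply: measurable_sum => i; apply: measurable_funX.
exact: ((measurable_fun_tnthP _).1 mf i).
Qed.

Lemma measurable_tsub d' (T : measurableType d') (f g : T -> Rd) :
  measurable_fun setT f -> measurable_fun setT g ->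
  measurable_fun setT (fun z => tsub (f z) (g z)).
Proof.
move=> mf mg; apply/measurable_fun_tnthP => i.
rewrite (_ : _ \o _ = (fun z => tnth (f z) i - tnth (g z) i)); last first.
  by apply/funext => z; rewrite /= tnth_mktuple.
apply: measurable_funB; first exact: ((measurable_fun_tnthP _).1 mf i).
exact: ((measurable_fun_tnthP _).1 mg i).
Qed.

Lemma measurable_gauss_kernel d' (T : measurableType d') (f : T -> R) (g : T -> Rd) :
  measurable_fun setT f -> measurable_fun setT g ->
  measurable_fun setT (fun z => gauss_kernel (f z) (g z)).
Proof.
move=> mf mg; apply: measurable_heat => //.
by apply: measurable_funX; exact: measurable_enorm.
Qed.

Lemma enorm_powN_ge0 r x : (0 <= enorm_powN x r)%E.
Proof. by rewrite /enorm_powN; case: ifP => // _; rewrite lee_fin powR_ge0. Qed.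

Lemma measurable_enorm_powN r d' (T : measurableType d') (f : T -> Rd) :
  measurable_fun setT f -> measurable_fun setT (fun z => enorm_powN (f z) r).
Proof.
move=> mf; apply: measurable_fun_ifT.
- apply: measurable_and => //; apply: measurable_fun_eqr => //.
  exact: measurable_enorm.
- exact: measurable_cst.
- apply/measurable_EFinP; apply: (measurableT_comp (measurable_powR _)).
  exact: measurable_enorm.
Qed.

End gauss.

(** * Perturbation series *)

Lemma fubini_tonelli_in {d1 d2} {T1 : measurableType d1} {T2 : measurableType d2}
    {R : realType} (m1 : {sigma_finite_measure set T1 -> \bar R})
    (m2 : {sigma_finite_measure set T2 -> \bar R}) (D : set T2)
    (f : T1 * T2 -> \bar R) :
  measurable D -> measurable_fun setT f -> (forall x, (0 <= f x)%E) ->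
  (\int[m1]_x \int[m2]_(y in D) f (x, y) = \int[m2]_(y in D) \int[m1]_x f (x, y))%E.
Proof.
move=> mD mf f0.
pose g := f \_ (setT `*` D).
have g0 x : (0 <= g x)%E by rewrite erestrict_ge0.
have mg : measurable_fun setT g.
  apply/(measurable_restrictT f); first exact: measurableX.
  exact: measurable_funTS.
have gE x y : g (x, y) = ((fun y => f (x, y)) \_ D) y.
  rewrite /g /patch; congr (if _ then _ else _).
  by apply/idP/idP; rewrite !inE/=; [case|].
transitivity (\int[m1]_x \int[m2]_y g (x, y))%E.
  apply: eq_integral => x _; rewrite integral_mkcond.
  by apply: eq_integral => y _; rewrite gE.
rewrite fubini_tonelli// [RHS]integral_mkcond; apply: eq_integral => y _.
under eq_integral do rewrite gE.
by rewrite /patch; case: ifP => // _; rewrite integral0.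
Qed.

(** The factor must be allowed to be +oo, the value of |y|^(-r) at the origin; there one nonzero
    term already makes the right side infinite. *)
Lemma nneseries_muler_le {R : realType} (a : nat -> \bar R) (k : \bar R) :
  (forall n, (0 <= a n)%E) -> (0 <= k)%E ->
  ((\sum_(0 <= n <oo) a n) * k <= \sum_(0 <= n <oo) (a n * k))%E.
Proof.
move=> a0; case: k => [k| |] k0 //.
  by rewrite muleC -nneseriesZl//; under eq_eseriesr do rewrite muleC.
have ak0 n : (0 <= a n * +oo)%E by rewrite mule_ge0.
have [h|/existsNP[n /eqP an0]] := pselect (forall n, a n = 0%E).
  by rewrite eseries0 ?mul0e ?nneseries_ge0// => n _ _.
rewrite (le_trans (leey _))// (le_trans _ (nneseries_lim_ge n.+1 _))//.
rewrite big_nat_recr//= gt0_muley ?lt0e ?an0 ?a0//.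
rewrite addey// gt_eqF// (lt_le_trans ltNy0)// sume_ge0//.
Qed.

Section perturbation.
Context {R : realType} {d : nat}.
Local Notation Rd := (d.-tuple (measurableTypeR R)).
Local Notation leb := (@lebesgue_tuple R d).
Local Notation mu := (@lebesgue_measure R).
Variables (p : R -> Rd -> Rd -> \bar R) (q h : Rd -> \bar R).
Hypothesis p0 : forall t x y, (0 <= p t x y)%E.
Hypothesis q0 : forall x, (0 <= q x)%E.
Hypothesis h0 : forall x, (0 <= h x)%E.
Hypothesis mp : measurable_fun setT (fun u : R * Rd * Rd => p u.1.1 u.1.2 u.2).
Hypothesis mq : measurable_fun setT q.
Hypothesis mh : measurable_fun setT h.

Local Notation term := (perturbation_term p q).

Lemma perturbation_term_ge0 n t x y : (0 <= term n t x y)%E.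
Proof.
elim: n t x y => [|n IH] t x y; first exact: p0.
apply: integral_ge0 => s _; apply: integral_ge0 => z _.
by rewrite !mule_ge0.
Qed.

Let measurable3 (f : R -> Rd -> Rd -> \bar R) :
  measurable_fun setT (fun u : R * Rd * Rd => f u.1.1 u.1.2 u.2) ->
  forall d' (T : measurableType d') (a : T -> R) (b c : T -> Rd),
  measurable_fun setT a -> measurable_fun setT b -> measurable_fun setT c ->
  measurable_fun setT (fun u => f (a u) (b u) (c u)).
Proof.
move=> mf d' T a b c ma mb mc.
apply: (measurableT_comp mf (g := fun u => ((a u, b u), c u))).
by apply: measurable_fun_pair => //; exact: measurable_fun_pair.
Qed.

Let measurable2 (f : R -> Rd -> \bar R) :
  measurable_fun setT (fun u : R * Rd => f u.1 u.2) ->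
  forall d' (T : measurableType d') (a : T -> R) (b : T -> Rd),
  measurable_fun setT a -> measurable_fun setT b ->
  measurable_fun setT (fun u => f (a u) (b u)).
Proof.
move=> mf d' T a b ma mb; apply: (measurableT_comp mf (g := fun u => (a u, b u))).
exact: measurable_fun_pair.
Qed.

Let mfst2 {d1 d2 d3} {T1 : measurableType d1} {T2 : measurableType d2}
  {T3 : measurableType d3} :
  measurable_fun setT (fun u : T1 * T2 * T3 => u.1.1).
Proof. exact: (measurableT_comp measurable_fst measurable_fst). Qed.

Let msnd2 {d1 d2 d3} {T1 : measurableType d1} {T2 : measurableType d2}
  {T3 : measurableType d3} :
  measurable_fun setT (fun u : T1 * T2 * T3 => u.1.2).
Proof. exact: (measurableT_comp measurable_snd measurable_fst). Qed.

Lemma measurable_perturbation_term n :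
  measurable_fun setT (fun u : R * Rd * Rd => term n u.1.1 u.1.2 u.2).
Proof.
elim: n => [|n IH]; first exact: mp.
pose G (v : (R * Rd * Rd) * R * Rd) : \bar R :=
  (p v.1.2 v.1.1.1.2 v.2 * q v.2 * term n (v.1.1.1.1 - v.1.2) v.2 v.1.1.2)%E.
have mG : measurable_fun setT G.
  have m1 : measurable_fun setT (fun v : (R * Rd * Rd) * R * Rd => v.1.1) by exact: mfst2.
  apply: emeasurable_funM.
    apply: emeasurable_funM; last exact: measurableT_comp.
    apply: (measurable3 _ mp) => //; first exact: msnd2.
    exact: (measurableT_comp msnd2 m1).
  apply: (measurable3 _ IH) => //.
    apply: measurable_funB; last exact: msnd2.
    exact: (measurableT_comp mfst2 m1).
  exact: (measurableT_comp measurable_snd m1).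
have G0 v : (0 <= G v)%E by rewrite /G !mule_ge0// perturbation_term_ge0.
(* The domain ]0, t[ depends on a variable of the function; moved into the integrand, it leaves a
   fixed measure for Tonelli. *)
pose F (w : (R * Rd * Rd) * R) : \bar R :=
  if (0 < w.2) && (w.2 < w.1.1.1) then (\int[leb]_z G (w, z))%E else 0%E.
have mF : measurable_fun setT F.
  apply: measurable_fun_ifT => //.
    apply: measurable_and; apply: measurable_fun_ltr => //.
    exact: (measurableT_comp measurable_fst mfst2).
  exact: measurable_fun_fubini_tonelli_F.
have F0 w : (0 <= F w)%E by rewrite /F; case: ifP => // _; exact: integral_ge0.
rewrite (_ : (fun u => _) = (fun u => \int[mu]_s F (u, s))%E).
  exact: measurable_fun_fubini_tonelli_F.
apply/funext => -[[t x] y] /=; rewrite integral_mkcond; apply: eq_integral => s _.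
by rewrite /F /patch /=; congr (if _ then _ else _); rewrite mem_setE in_itv.
Qed.

Let H n t x : \bar R := (\int[leb]_y (term n t x y * h y))%E.

Let H0 n t x : (0 <= H n t x)%E.
Proof. by apply: integral_ge0 => y _; rewrite mule_ge0// perturbation_term_ge0. Qed.

Let mH n : measurable_fun setT (fun u : R * Rd => H n u.1 u.2).
Proof.
apply: (@measurable_fun_fubini_tonelli_F _ _ _ _ _ leb
   (fun u : (R * Rd) * Rd => term n u.1.1 u.1.2 u.2 * h u.2)%E).
  apply: emeasurable_funM; first exact: measurable_perturbation_term.
  exact: measurableT_comp.
by move=> u; rewrite mule_ge0// perturbation_term_ge0.
Qed.

Let mpqH n t x : measurable_fun setT
  (fun u : R * Rd => p u.1 x u.2 * q u.2 * H n (t - u.1) u.2)%E.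
Proof.
apply: emeasurable_funM.
  apply: emeasurable_funM; last exact: measurableT_comp.
  exact: (measurable3 _ mp).
by apply: (measurable2 _ (mH n)) => //; exact: measurable_funB.
Qed.

(** Tonelli brings the integration against h(y) dy inside those over s and z. *)
Let HS n t x : H n.+1 t x =
  (\int[mu]_(s in `]0%R, t[) \int[leb]_z (p s x z * q z * H n (t - s) z))%E.
Proof.
pose G (v : Rd * R * Rd) : \bar R :=
  (p v.1.2 x v.2 * q v.2 * term n (t - v.1.2) v.2 v.1.1 * h v.1.1)%E.
have mG : measurable_fun setT G.
  apply: emeasurable_funM.
    apply: emeasurable_funM.
      apply: emeasurable_funM; last exact: measurableT_comp.
      by apply: (measurable3 _ mp) => //; exact: msnd2.
    apply: (measurable3 _ (measurable_perturbation_term n)) => //.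
      by apply: measurable_funB => //; exact: msnd2.
    exact: mfst2.
  by apply: (measurableT_comp mh); exact: mfst2.
have G0 v : (0 <= G v)%E by rewrite /G !mule_ge0// perturbation_term_ge0.
transitivity (\int[leb]_y \int[mu]_(s in `]0%R, t[) \int[leb]_z G ((y, s), z))%E.
  apply: eq_integral => y _ /=.
  have m1 : measurable_fun setT
      (fun u : R * Rd => p u.1 x u.2 * q u.2 * term n (t - u.1) u.2 y)%E.
    apply: emeasurable_funM.
      apply: emeasurable_funM; last exact: measurableT_comp.
      exact: (measurable3 _ mp).
    by apply: (measurable3 _ (measurable_perturbation_term n)) => //; exact: measurable_funB.
  have pos s z : (0 <= p s x z * q z * term n (t - s) z y)%E.
    by rewrite !mule_ge0// perturbation_term_ge0.
  rewrite -ge0_integralZr//; last 2 first.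
  - apply: measurable_funTS.
    exact: (@measurable_fun_fubini_tonelli_F _ _ _ _ _ leb _ m1 (fun u => pos u.1 u.2)).
  - by move=> s _; apply: integral_ge0.
  apply: eq_integral => s _; rewrite -ge0_integralZr//.
  exact: (measurableT_comp m1 (pair1_measurable s)).
rewrite (@fubini_tonelli_in _ _ _ _ _ leb mu _ (fun w => \int[leb]_z G (w, z))%E)//;
  last 2 first.
- exact: measurable_fun_fubini_tonelli_F.
- by move=> w; exact: integral_ge0.
apply: eq_integral => s _.
pose G' (v : Rd * Rd) := G ((v.1, s), v.2).
have mG' : measurable_fun setT G'.
  apply: (measurableT_comp mG (g := fun v : Rd * Rd => ((v.1, s), v.2))).
  by apply: measurable_fun_pair => //; apply: measurable_fun_pair.
rewrite (@fubini_tonelli _ _ _ _ _ leb leb G')//; last by move=> v; exact: G0.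
apply: eq_integral => z _; rewrite -ge0_integralZl//; last 3 first.
- apply: emeasurable_funM => //.
  by apply: (measurable3 _ (measurable_perturbation_term n)).
- by move=> y _; rewrite mule_ge0// perturbation_term_ge0.
- by rewrite mule_ge0.
by apply: eq_integral => y _; rewrite /G' /G /= !muleA.
Qed.

Hypothesis super : forall t x, 0 < t ->
  (\int[leb]_y (p t x y * h y) +
   \int[mu]_(s in `]0%R, t[) \int[leb]_z (p s x z * (q z * h z)) <= h x)%E.

Lemma perturbation_partial_le N t x : 0 < t -> (\sum_(n < N) H n t x <= h x)%E.
Proof.
elim: N t x => [|N IH] t x t0; first by rewrite big_ord0.
rewrite big_ord_recl; apply: le_trans (super _ x t0); apply: leeD2l.
have mpq : measurable_fun setT (fun u : R * Rd => p u.1 x u.2 * (q u.2 * h u.2))%E.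
  apply: emeasurable_funM; first exact: (measurable3 _ mp).
  by apply: emeasurable_funM; exact: measurableT_comp.
have pos n s z : (0 <= p s x z * q z * H n (t - s) z)%E by rewrite !mule_ge0.
have mi n : measurable_fun setT
    (fun s => \int[leb]_z (p s x z * q z * H n (t - s) z))%E.
  exact: (@measurable_fun_fubini_tonelli_F _ _ _ _ _ leb _ (mpqH n t x) (fun u => pos n u.1 u.2)).
have i0 n s : (0 <= \int[leb]_z (p s x z * q z * H n (t - s) z))%E.
  by apply: integral_ge0.
rewrite (eq_bigr (fun n : 'I_N => \int[mu]_(s in `]0%R, t[) \int[leb]_z
  (p s x z * q z * H n (t - s) z))%E); last by move=> n _; exact: HS.
rewrite -ge0_integral_sum//; last first.
  by move=> n; apply: measurable_funTS; exact: mi.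
apply: ge0_le_integral => //.
- by move=> s _; apply: sume_ge0.
- by apply: measurable_funTS; apply: emeasurable_sum => n; exact: mi.
- apply: measurable_funTS.
  apply: (@measurable_fun_fubini_tonelli_F _ _ _ _ _ leb _ mpq) => u.
  by rewrite !mule_ge0.
move=> s /=; rewrite in_itv/= => /andP[s0 st].
rewrite -ge0_integral_sum//; last first.
  by move=> n; exact: (measurableT_comp (mpqH n t x) (pair1_measurable s)).
apply: ge0_le_integral => //.
- by move=> z _; apply: sume_ge0.
- apply: emeasurable_sum => n.
  exact: (measurableT_comp (mpqH n t x) (pair1_measurable s)).
- exact: (measurableT_comp mpq (pair1_measurable s)).
move=> z _; rewrite -ge0_sume_distrr// muleA lee_wpmul2l ?mule_ge0//.
(* On the open time interval t - s > 0, so the induction hypothesis, general in time and space,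
   applies at (t - s, z). *)
by apply: IH; rewrite subr_gt0.
Qed.

Lemma schrodinger_perturbation_le t x : 0 < t ->
  (\int[leb]_y (schrodinger_perturbation p q t x y * h y) <= h x)%E.
Proof.
move=> t0.
have mt n : measurable_fun setT (fun y => term n t x y * h y)%E.
  apply: emeasurable_funM => //.
  by apply: (measurable3 _ (measurable_perturbation_term n)).
have pos n y : (0 <= term n t x y * h y)%E by rewrite mule_ge0// perturbation_term_ge0.
apply: (@le_trans _ _ (\int[leb]_y \sum_(0 <= n <oo) (term n t x y * h y))%E).
  apply: ge0_le_integral => //.
  - move=> y _; rewrite mule_ge0//; apply: nneseries_ge0 => n _ _.
    exact: perturbation_term_ge0.
  - apply: emeasurable_funM => //; apply: ge0_emeasurable_sum => //.
      by move=> n y _ _; exact: perturbation_term_ge0.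
    by move=> n _; apply: (measurable3 _ (measurable_perturbation_term n)).
  - by apply: ge0_emeasurable_sum => // n y _ _; exact: pos.
  - move=> y _; apply: nneseries_muler_le => // n; exact: perturbation_term_ge0.
rewrite integral_nneseries//; apply: lime_le.
  by apply: is_cvg_nneseries => n _ _; exact: H0.
apply: nearW => N; rewrite big_mkord; exact: perturbation_partial_le.
Qed.

End perturbation.

(** The recursion evaluates the kernel at positive times only, which permits replacing p by its
    jointly measurable version. *)
Lemma eq_perturbation_term {R : realType} {d : nat}
    (p p' : R -> d.-tuple (measurableTypeR R) -> d.-tuple (measurableTypeR R) -> \bar R)
    (q : d.-tuple (measurableTypeR R) -> \bar R) n t x y :
  (forall t x y, 0 < t -> p t x y = p' t x y) -> 0 < t ->
  perturbation_term p q n t x y = perturbation_term p' q n t x y.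
Proof.
move=> pp'; elim: n t x y => [|n IH] t x y t0 /=; first exact: pp'.
apply: eq_integral => s; rewrite inE/= in_itv/= => /andP[s0 st].
by apply: eq_integral => z _; rewrite pp'// IH// subr_gt0.
Qed.

(** * Mixtures *)

(* In the library the sigma-finite structure of [m1 \x m2] is shadowed by the
   one for products of subprobabilities, hence this alias. *)
Section prod_measure.
Context {d1 d2} {T1 : measurableType d1} {T2 : measurableType d2} {R : realType}.
Variables (m1 : {sigma_finite_measure set T1 -> \bar R}).
Variables (m2 : {sigma_finite_measure set T2 -> \bar R}).

Definition prod_measure : set (T1 * T2) -> \bar R := (m1 \x m2)%E.

HB.instance Definition _ := Measure.on prod_measure.

Let prod_measure_sigma_finite : sigma_finite setT prod_measure.
Proof.
have /sigma_finiteP[F [TF ndF Foo]] := sigma_finiteT m1.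
have /sigma_finiteP[G [TG ndG Goo]] := sigma_finiteT m2.
exists (fun n => F n `*` G n) => [|n]; last first.
  have [mF F1] := Foo n; have [mG G1] := Goo n; split; first exact: measurableX.
  by rewrite /prod_measure product_measure1E// lte_mul_pinfty// ge0_fin_numE.
apply/esym/seteqP; split => // -[x y] _.
have [i _ Fi] : (\bigcup_i F i) x by rewrite -TF.
have [j _ Gj] : (\bigcup_i G i) y by rewrite -TG.
exists (maxn i j) => //; split => /=.
- by apply: subsetPset Fi; apply: ndF; exact: leq_maxl.
- by apply: subsetPset Gj; apply: ndG; exact: leq_maxr.
Qed.

HB.instance Definition _ := Measure_isSigmaFinite.Build _ _ _ prod_measure
  prod_measure_sigma_finite.

Lemma ge0_integral_prod_measure (f : T1 * T2 -> \bar R) :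
  measurable_fun setT f -> (forall z, (0 <= f z)%E) ->
  (\int[prod_measure]_z f z = \int[m1]_x \int[m2]_y f (x, y))%E.
Proof. exact: fubini_tonelli1. Qed.

End prod_measure.

Lemma ge0_integral_prodM {d1 d2} {T1 : measurableType d1} {T2 : measurableType d2}
    {R : realType} (m1 : {sigma_finite_measure set T1 -> \bar R})
    (m2 : {sigma_finite_measure set T2 -> \bar R}) (f : T1 -> R) (g : T2 -> R) :
  measurable_fun setT f -> measurable_fun setT g ->
  (forall x, 0 <= f x) -> (forall y, 0 <= g y) ->
  (\int[prod_measure m1 m2]_z (f z.1 * g z.2)%:E =
   (\int[m1]_x (f x)%:E) * (\int[m2]_y (g y)%:E))%E.
Proof.
move=> mf mg f0 g0.
rewrite (ge0_integral_prod_measure _ _ (fun z : T1 * T2 => (f z.1 * g z.2)%:E)); last 2 first.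
- by apply/measurable_EFinP; apply: measurable_funM; exact: measurableT_comp.
- by move=> z; rewrite lee_fin mulr_ge0.
rewrite /= -ge0_integralZr//; last 3 first.
- exact/measurable_EFinP.
- by move=> x _; rewrite lee_fin.
- by apply: integral_ge0 => y _; rewrite lee_fin.
apply: eq_integral => x _; rewrite -ge0_integralZl_EFin//.
- by move=> y _; rewrite lee_fin.
- exact/measurable_EFinP.
Qed.

(** The image of a product measure under a sum is a convolution, whose transform is the product of
    the transforms. *)
Lemma is_laplace_prod {d1 d2} {T1 : measurableType d1} {T2 : measurableType d2}
    {R : realType} (m1 : {sigma_finite_measure set T1 -> \bar R})
    (m2 : {sigma_finite_measure set T2 -> \bar R}) S1 S2 rho1 rho2 L1 L2 :
  is_laplace m1 S1 rho1 L1 -> is_laplace m2 S2 rho2 L2 ->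
  is_laplace (prod_measure m1 m2) (fun z => S1 z.1 + S2 z.2) (fun z => rho1 z.1 * rho2 z.2)
    (fun u => L1 u * L2 u).
Proof.
move=> H1 H2; have [mS1 mr1 r1 pos1 E1] := H1; have [mS2 mr2 r2 pos2 E2] := H2.
split.
- by apply: measurable_funD; exact: measurableT_comp.
- by apply: measurable_funM; exact: measurableT_comp.
- by move=> z; rewrite mulr_ge0.
- move=> z; rewrite mulf_eq0 negb_or => /andP[/pos1 h1 /pos2 h2].
  exact: addr_gt0.
move=> u u0; rewrite EFinM -E1// -E2// -ge0_integral_prodM; last 4 first.
- exact: measurable_laplace H1 _.
- exact: measurable_laplace H2 _.
- by move=> x; rewrite mulr_ge0 ?expR_ge0.
- by move=> x; rewrite mulr_ge0 ?expR_ge0.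
apply: eq_integral => z _; rewrite mulrDr opprD expRD; congr EFin.
by rewrite mulrACA.
Qed.

(** Only [S] varies with the mixing parameter, as in the scaling form of the subordinator. The
    transform is required where [theta] is nonzero, since [theta] will be supported by ]0, t[ and
    the scaled law makes sense for s > 0. *)
Lemma is_laplace_mix {d1 d2} {T1 : measurableType d1} {T2 : measurableType d2}
    {R : realType} (m1 : {sigma_finite_measure set T1 -> \bar R})
    (m2 : {sigma_finite_measure set T2 -> \bar R}) (theta : T1 -> R)
    (S : T1 -> T2 -> R) (rho : T2 -> R) (K : T1 -> R -> R) (L : R -> R) :
  measurable_fun setT theta -> (forall x, 0 <= theta x) ->
  measurable_fun setT (fun z => S z.1 z.2) ->
  measurable_fun setT rho -> (forall x, 0 <= rho x) ->
  (forall x, theta x != 0 -> is_laplace m2 (S x) rho (K x)) ->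
  (forall u, 0 < u -> (\int[m1]_x (theta x * K x u)%:E = (L u)%:E)%E) ->
  is_laplace (prod_measure m1 m2) (fun z => S z.1 z.2) (fun z => theta z.1 * rho z.2) L.
Proof.
move=> mt t0 mS mr r0 H HL.
have mtr : measurable_fun setT (fun z : T1 * T2 => theta z.1 * rho z.2).
  by apply: measurable_funM; exact: measurableT_comp.
split => //.
- by move=> z; rewrite mulr_ge0.
- move=> z; rewrite mulf_eq0 negb_or => /andP[/H h1 h2].
  exact: laplace_pos h1 _ h2.
move=> u u0; rewrite -HL//.
rewrite (ge0_integral_prod_measure _ _ (fun z : T1 * T2 =>
  (expR (- (u * S z.1 z.2)) * (theta z.1 * rho z.2))%:E)); last 2 first.
- apply/measurable_EFinP; apply: measurable_funM => //.
  apply: measurableT_comp => //; apply: measurable_funN.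
  exact: measurable_funM.
- by move=> z; rewrite lee_fin !mulr_ge0 ?expR_ge0.
apply: eq_integral => x _ /=.
have [tx0|tx0] := eqVneq (theta x) 0.
  by rewrite tx0 mul0r integral0_eq// => y _; rewrite mul0r mulr0.
under eq_integral do rewrite mulrCA EFinM.
rewrite ge0_integralZl_EFin//.
- by rewrite (laplaceE _ _ _ _ (H _ tx0)).
- by move=> y _; rewrite lee_fin mulr_ge0 ?expR_ge0.
- by apply/measurable_EFinP; exact: measurable_laplace (H _ tx0) _.
Qed.

(** * Power weights on the half-line *)

Section half_line.
Context {R : realType}.
Local Notation mu := (@lebesgue_measure R).

(** Extended by zero, so that a nonzero weight forces w > 0, as [is_laplace] demands. *)
Definition half_powR (b w : R) : R := w `^ (b - 1) * \1_`]0, +oo[ w.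

Lemma half_powR_ge0 b w : 0 <= half_powR b w.
Proof. by rewrite mulr_ge0 ?powR_ge0. Qed.

Lemma half_powR_gt0 b w : half_powR b w != 0 -> 0 < w.
Proof.
rewrite mulf_eq0 negb_or => /andP[_]; rewrite indicE.
by case: (boolP (w \in _)) => [|_ /eqP//]; rewrite inE/= in_itv/= andbT.
Qed.

Lemma measurable_half_powR b : measurable_fun setT (half_powR b).
Proof. by apply: measurable_funM; first exact: measurable_powR. Qed.

Lemma integral_half_powR (f : R -> R) b :
  (\int[mu]_w (f w * half_powR b w)%:E =
   \int[mu]_(w in `]0%R, +oo[) (f w * w `^ (b - 1))%:E)%E.
Proof.
rewrite [RHS]integral_mkcond; apply: eq_integral => w _.
rewrite /half_powR /patch indicE; case: ifP => _; first by rewrite mulr1.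
by rewrite !mulr0.
Qed.

Lemma is_laplace_half_powR b : 0 < b ->
  is_laplace mu id (half_powR b) (fun u => u `^ (- b) * Gamma b).
Proof.
move=> b0; split => //.
- exact: measurable_half_powR.
- exact: half_powR_ge0.
- exact: half_powR_gt0.
move=> u u0; rewrite (integral_half_powR (fun w => expR (- (u * w)))).
by rewrite -gamma_laplace//; apply: eq_integral => w _; rewrite mulrC.
Qed.

(** Up to the factor 1/U, the distribution function at t of the exponential law of rate U. *)
Lemma integral_itv_expR (t U : R) : 0 < t -> 0 < U ->
  (\int[mu]_s (\1_`]0, t[ s * expR (- (s * U)))%:E = ((1 - expR (- (t * U))) / U)%:E)%E.
Proof.
move=> t0 U0; have := @exponential_prob_itv0c R U t t0.
rewrite /exponential_prob => E.
transitivity (\int[mu]_(s in `[0%R, t]) (U^-1 * exponential_pdf U s)%:E)%E.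
  have mf D : measurable_fun D (fun s => (U^-1 * exponential_pdf U s)%:E).
    apply/measurable_EFinP; apply: measurable_funTS; apply: measurable_funM => //.
    exact: measurable_exponential_pdf.
  rewrite (@integral_itv_bndoo _ 0 t _ true false)//.
  rewrite [RHS]integral_mkcond; apply: eq_integral => s _.
  rewrite /patch indicE; case: ifPn => [|_]; last by rewrite mul0r.
  rewrite inE/= in_itv/= => /andP[s0 _]; rewrite mul1r exponential_pdfE ?(ltW s0)//.
  by rewrite mulKf ?gt_eqF//; congr (expR _)%:E; ring.
under eq_integral do rewrite EFinM.
rewrite ge0_integralZl_EFin ?invr_ge0 ?(ltW U0)//.
- by rewrite E -EFinB -EFinM mulrC; congr ((1 - expR _) / _)%:E; ring.
- by move=> s _; rewrite lee_fin exponential_pdf_ge0// ltW.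
- apply/measurable_EFinP; apply: measurable_funTS; exact: measurable_exponential_pdf.
Qed.

End half_line.

(** * The stable semigroup *)

(** The identity for the constant in q, divided by C_r. Here A = (4 pi)^(-d/2), B = 2^r, C =
    2^alpha, a1 = Gamma(r/2), a2 = Gamma((r+alpha)/2), G = Gamma(g), G' = Gamma(g'). *)
Lemma riesz_ratio {F : fieldType} (A B C a1 a2 G G' : F) :
  A != 0 -> B != 0 -> C != 0 -> a1 != 0 -> a2 != 0 -> G' != 0 ->
  C * a2 * G / (a1 * G') / (A * (B * C) * a2) = (A * B * a1)^-1 * (G / G').
Proof. by move=> *; field; do ?[apply/andP; split]. Qed.

(** The Laplace identity of the overview with its Gamma factors: E = e^(-tU), V = U, p = u^(-g'),
    hence p / V = u^(-g). *)
Lemma occupation_balance {F : fieldType} (E p V G G' : F) :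
  V != 0 -> G' != 0 ->
  E * (p / V * G) + G / G' * ((1 - E) / V) * (p * G') = p / V * G.
Proof. by move=> *; field; do ?[apply/andP; split]. Qed.

(** * Powers of the norm as Gaussian mixtures *)

Section riesz.
Context {R : realType} {d : nat}.
Local Notation Rd := (d.-tuple (measurableTypeR R)).
Local Notation mu := (@lebesgue_measure R).

(** The constant C_r: the mixture of Gaussian kernels with weight w^((d-r)/2 - 1) dw equals C_r
    |x|^(-r). *)
Definition riesz_const (r : R) : R :=
  (4 * pi) `^ (- (d%:R / 2)) * 2 `^ r * Gamma (r / 2).

Lemma riesz_const_gt0 r : 0 < r -> 0 < riesz_const r.
Proof.
move=> r0; rewrite mulr_gt0 ?Gamma_gt0 ?divr_gt0// mulr_gt0// powR_gt0//.
by rewrite mulr_gt0// pi_gt0.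
Qed.

Lemma gauss_riesz r (z : Rd) : 0 < r -> enorm z != 0 ->
  (\int[mu]_w (gauss_kernel w z * half_powR ((d%:R - r) / 2) w)%:E =
   (riesz_const r)%:E * enorm_powN z r)%E.
Proof.
move=> r0 z0; have z0' : 0 < enorm z by rewrite lt_def z0 enorm_ge0.
rewrite (integral_half_powR (fun w => gauss_kernel w z)).
have E : d%:R / 2 - (d%:R - r) / 2 = r / 2 by field.
rewrite heat_riesz ?exprn_gt0// E ?divr_gt0// /enorm_powN (negbTE z0) andbF -EFinM.
congr EFin; rewrite /riesz_const.
have -> : (enorm z ^+ 2 / 4) `^ (- (r / 2)) = enorm z `^ (- r) * 2 `^ r.
  rewrite (_ : _ / 4 = (enorm z / 2) ^+ 2); last by field.
  rewrite -powR_mulrn ?divr_ge0 ?enorm_ge0// -powRrM.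
  rewrite (_ : 2 * _ = - r); last by field.
  rewrite powRM ?enorm_ge0// -(@powR_inv1 _ 2)// -powRrM.
  by congr (_ * _ `^ _); ring.
ring.
Qed.

End riesz.

(* The coefficient of |x|^(-alpha) in the potential q. *)
Definition riesz_rate {R : realType} (d : nat) (alpha r : R) : R :=
  2 `^ alpha * Gamma ((r + alpha) / 2) * Gamma ((d%:R - r) / 2) /
  (Gamma (r / 2) * Gamma ((d%:R - alpha - r) / 2)).

Lemma riesz_rate_gt0 {R : realType} (d : nat) (alpha r : R) :
  0 < alpha -> 0 < r -> r < d%:R - alpha -> 0 < riesz_rate d alpha r.
Proof.
move=> a0 r0 rda; have h1 : 0 < r + alpha by exact: addr_gt0.
have h2 : 0 < d%:R - alpha - r by rewrite subr_gt0.
have h3 : 0 < d%:R - r by lra.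
by rewrite /riesz_rate divr_gt0// !mulr_gt0// ?powR_gt0// ?Gamma_gt0// divr_gt0.
Qed.

(* [eta t] is not assumed measurable in [t]; with [e = eta 1] this version of
   p_t(x), based on the scaling property, is jointly measurable in (t, x). *)
Definition rescaled_density {R : realType} {d : nat} (alpha : R) (e : R -> R)
    (t : R) (x : d.-tuple (measurableTypeR R)) : \bar R :=
  (\int[lebesgue_measure]_s (gauss_kernel (t `^ (2 / alpha) * s) x * e s)%:E)%E.

(** * The subordinated semigroup acting on mixtures *)

Section stable.
Context {R : realType} {d : nat}.
Local Notation Rd := (d.-tuple (measurableTypeR R)).
Local Notation leb := (@lebesgue_tuple R d).
Local Notation mu := (@lebesgue_measure R).
Variables (alpha : R) (eta : R -> R -> R).
Hypotheses (d_gt0 : (0 < d)%N) (alpha_gt0 : 0 < alpha).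
Hypothesis eta_density : forall t : R, 0 < t ->
  is_stable_subordinator_density alpha t (eta t).

Let exponent (t u : R) := expR (- (t * u `^ (alpha / 2))).

Lemma density_half_line (f : R -> R) t : 0 < t ->
  (\int[mu]_(s in `]0%R, +oo[) (f s * eta t s)%:E =
   \int[mu]_s (f s * eta t s)%:E)%E.
Proof.
move=> t0; rewrite integral_mkcond; apply: eq_integral => s _.
rewrite /patch; case: ifPn => //; rewrite notin_setE/= in_itv/= andbT => /negP.
by rewrite -leNgt => s0; rewrite (ssd_eq0 (eta_density t t0))// mulr0.
Qed.

Lemma is_laplace_density t : 0 < t -> is_laplace mu id (eta t) (exponent t).
Proof.
move=> t0; have [me e0 e00 eL] := eta_density t t0; split => //.
  by move=> s; apply: contraR; rewrite -leNgt => /e00 ->.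
by move=> u u0; rewrite -density_half_line// eL// ltW.
Qed.

Let e := eta 1.

Let e_ge0 s : 0 <= e s. Proof. exact: (ssd_ge0 (eta_density 1 ltr01)). Qed.

Let me : measurable_fun setT e.
Proof. exact: (ssd_measurable (eta_density 1 ltr01)). Qed.

Let e_gt0 s : e s != 0 -> 0 < s.
Proof. exact: (laplace_pos _ _ _ _ (is_laplace_density 1 ltr01)). Qed.

(** Stable scaling: replacing u by u t^(2/alpha) in u^(alpha/2) produces the factor t. *)
Lemma is_laplace_rescaled t : 0 < t ->
  is_laplace mu (fun s => t `^ (2 / alpha) * s) e (exponent t).
Proof.
move=> t0; have a0 : 0 < t `^ (2 / alpha) by rewrite powR_gt0.
split => //.
- exact: measurable_funM.
- by move=> s /e_gt0 s0; rewrite mulr_gt0.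
move=> u u0; under eq_integral do rewrite mulrA.
have ua0 : 0 < u * t `^ (2 / alpha) by exact: mulr_gt0.
rewrite [LHS](laplaceE _ _ _ _ (is_laplace_density 1 ltr01) _ ua0).
have a1 : 2 / alpha * (alpha / 2) = 1 by field; rewrite gt_eqF.
rewrite /exponent mul1r (powRM _ (ltW u0) (ltW a0)) -powRrM a1.
by rewrite (powRr1 (ltW t0)) mulrC.
Qed.

Local Notation pt := (@rescaled_density R d alpha e).

(** Densities with the same transform may differ on a null set, but the two integrals against k_c
    agree for every c >= 0. The equality therefore holds at every x, the origin included. *)
Lemma subordinated_rescaled t (x : Rd) : 0 < t ->
  subordinated_density eta t x = pt t x.
Proof.
move=> t0; rewrite /subordinated_density (density_half_line (gauss_kernel^~ x))//.
apply: (heat_laplace_unique _ d_gt0 _ _ _ _ _ _ _ _ (is_laplace_density t t0)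
  (is_laplace_rescaled t t0)).
exact: sqr_ge0.
Qed.

Lemma rescaled_density_ge0 t x : (0 <= pt t x)%E.
Proof. by apply: integral_ge0 => s _; rewrite lee_fin mulr_ge0// gauss_kernel_ge0. Qed.

Lemma measurable_rescaled_density d' (T : measurableType d') (f : T -> R)
    (g : T -> Rd) : measurable_fun setT f -> measurable_fun setT g ->
  measurable_fun setT (fun z => pt (f z) (g z)).
Proof.
move=> mf mg; apply: (@measurable_fun_fubini_tonelli_F _ _ _ _ _ mu
  (fun v : T * R => (gauss_kernel (f v.1 `^ (2 / alpha) * v.2) (g v.1) * e v.2)%:E)).
  apply/measurable_EFinP; apply: measurable_funM; last exact: measurableT_comp.
  apply: measurable_gauss_kernel; last exact: measurableT_comp.
  apply: measurable_funM => //.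
  by apply: (measurableT_comp (measurable_powR _)); exact: measurableT_comp.
by move=> v; rewrite lee_fin mulr_ge0// gauss_kernel_ge0.
Qed.

Lemma rescaled_density_mass t (x : Rd) : 0 < t ->
  (\int[leb]_y pt t (tsub y x) = 1)%E.
Proof.
move=> t0; rewrite (@fubini_tonelli _ _ _ _ _ leb mu (fun v : Rd * R =>
  (gauss_kernel (t `^ (2 / alpha) * v.2) (tsub v.1 x) * e v.2)%:E)) /=; last 2 first.
- apply/measurable_EFinP; apply: measurable_funM; last exact: measurableT_comp.
  apply: measurable_gauss_kernel; first exact: measurable_funM.
  exact: measurable_tsub.
- by move=> v; rewrite lee_fin mulr_ge0// gauss_kernel_ge0.
transitivity (\int[mu]_s (e s)%:E)%E.
  apply: eq_integral => s _.
  have [es0|es0] := eqVneq (e s) 0.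
    by rewrite es0 integral0_eq// => y _; rewrite mulr0.
  under eq_integral do rewrite mulrC EFinM.
  rewrite ge0_integralZl_EFin//.
  - by rewrite integral_gauss ?mule1// mulr_gt0 ?powR_gt0// e_gt0.
  - by move=> y _; rewrite lee_fin gauss_kernel_ge0.
  - apply/measurable_EFinP; apply: measurable_gauss_kernel => //.
    exact: measurable_tsub.
(* The Laplace transform at u = 0 is the total mass; u^(alpha/2) vanishes there because alpha >
   0. *)
have := ssd_laplace (eta_density 1 ltr01) (lexx 0).
rewrite powR0 ?mulr0 ?oppr0 ?expR0; last by rewrite gt_eqF// divr_gt0.
move=> <-; rewrite (density_half_line (fun s => expR (- (0 * s))))//.
by apply: eq_integral => s _; rewrite mul0r oppr0 expR0 mul1r.
Qed.

(** P_t applied to the mixture with weight w^(b-1), written as one integral of the kernel at the sum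
    of the two times. *)
Let I1 (b t c : R) : \bar R := (\int[prod_measure mu mu]_z
  (heat d (t `^ (2 / alpha) * z.1 + z.2) c * (e z.1 * half_powR b z.2))%:E)%E.

Lemma rescaled_density_conv b t (x : Rd) : 0 < t ->
  (\int[leb]_y (pt t (tsub y x) * \int[mu]_w (gauss_kernel w y * half_powR b w)%:E) =
   I1 b t (enorm x ^+ 2))%E.
Proof.
move=> t0; set a := t `^ (2 / alpha); have a0 : 0 < a by rewrite powR_gt0.
have mhp : measurable_fun setT (@half_powR R b) by exact: measurable_half_powR.
pose F (v : Rd * (R * R)) : \bar R := (gauss_kernel (a * v.2.1) (tsub v.1 x) * e v.2.1
    * (gauss_kernel v.2.2 v.1 * half_powR b v.2.2))%:E.
have mF : measurable_fun setT F.
  have m21 : measurable_fun setT (fun v : Rd * (R * R) => v.2.1).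
    exact: (measurableT_comp measurable_fst measurable_snd).
  have m22 : measurable_fun setT (fun v : Rd * (R * R) => v.2.2).
    exact: (measurableT_comp measurable_snd measurable_snd).
  apply/measurable_EFinP; apply: measurable_funM; apply: measurable_funM.
  - apply: measurable_gauss_kernel; first exact: measurable_funM.
    exact: measurable_tsub.
  - exact: measurableT_comp.
  - exact: measurable_gauss_kernel.
  - exact: measurableT_comp.
have F0 v : (0 <= F v)%E.
  rewrite /F lee_fin; apply: (mulr_ge0 (mulr_ge0 _ _) (mulr_ge0 _ _)) => //;
    by rewrite ?gauss_kernel_ge0 ?half_powR_ge0.
transitivity (\int[leb]_y \int[prod_measure mu mu]_z F (y, z))%E.
  apply: eq_integral => y _.
  rewrite (@ge0_integral_prodM _ _ _ _ _ mu mu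
    (fun s => gauss_kernel (a * s) (tsub y x) * e s)
    (fun w => gauss_kernel w y * half_powR b w))//.
  - apply: measurable_funM => //; apply: measurable_gauss_kernel => //.
  - by apply: measurable_funM => //; exact: measurable_gauss_kernel.
  - by move=> s; rewrite mulr_ge0 ?gauss_kernel_ge0.
  - by move=> w; rewrite mulr_ge0 ?gauss_kernel_ge0 ?half_powR_ge0.
rewrite (@fubini_tonelli _ _ _ _ _ leb (prod_measure mu mu) F)//.
apply: eq_integral => -[s w] _ /=; rewrite /F /=.
(* The Gaussian convolution formula requires positive times; where one of them is not positive, its
   weight vanishes. *)
have [es0|/e_gt0 s0] := eqVneq (e s) 0.
  by rewrite es0 mul0r mulr0 integral0_eq// => y _; rewrite mulr0 mul0r.
have [ws0|/half_powR_gt0 w0] := eqVneq (half_powR b w) 0.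
  by rewrite ws0 !mulr0 integral0_eq// => y _; rewrite !mulr0.
rewrite EFinM muleC -gauss_kernelE -gauss_conv ?mulr_gt0//.
have ew0 : 0 <= e s * half_powR b w by apply: mulr_ge0 => //; exact: half_powR_ge0.
rewrite -ge0_integralZl_EFin//.
- apply: eq_integral => y _; rewrite -EFinM; congr EFin; ring.
- by move=> y _; rewrite lee_fin mulr_ge0 ?gauss_kernel_ge0.
- apply/measurable_EFinP; apply: measurable_funM; apply: measurable_gauss_kernel => //.
  exact: measurable_tsub.
Qed.

Lemma rescaled_density_riesz r t (x : Rd) : 0 < r -> 0 < t ->
  (\int[leb]_y (pt t (tsub y x) * enorm_powN y r) =
   ((@riesz_const R d r)^-1)%:E * I1 ((d%:R - r) / 2) t (enorm x ^+ 2))%E.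
Proof.
move=> r0 t0; have C0 := @riesz_const_gt0 R d _ r0.
rewrite -rescaled_density_conv//.
have mg : measurable_fun setT (fun y : Rd =>
    \int[mu]_w (gauss_kernel w y * half_powR ((d%:R - r) / 2) w)%:E)%E.
  apply: (@measurable_fun_fubini_tonelli_F _ _ _ _ _ mu (fun v : Rd * R =>
    (gauss_kernel v.2 v.1 * half_powR ((d%:R - r) / 2) v.2)%:E)).
    apply/measurable_EFinP; apply: measurable_funM.
      exact: measurable_gauss_kernel.
    by apply: measurableT_comp => //; exact: measurable_half_powR.
  by move=> v; rewrite lee_fin mulr_ge0 ?gauss_kernel_ge0 ?half_powR_ge0.
have g0 (y : Rd) : (0 <= \int[mu]_w
    (gauss_kernel w y * half_powR ((d%:R - r) / 2) w)%:E)%E.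
  apply: integral_ge0 => w _.
  by rewrite lee_fin mulr_ge0 ?gauss_kernel_ge0 ?half_powR_ge0.
have mp : measurable_fun setT (fun y => pt t (tsub y x)).
  by apply: measurable_rescaled_density => //; exact: measurable_tsub.
rewrite -ge0_integralZl_EFin ?invr_ge0 ?(ltW C0)//; last 2 first.
- by move=> y _; rewrite mule_ge0// rescaled_density_ge0.
- exact: emeasurable_funM.
apply: ge0_ae_eq_integral => //.
- by apply: emeasurable_funM => //; exact: measurable_enorm_powN.
- by apply: measurable_funeM; exact: emeasurable_funM.
- by move=> y _; rewrite mule_ge0 ?rescaled_density_ge0 ?enorm_powN_ge0.
- move=> y _; apply: mule_ge0; first by rewrite lee_fin invr_ge0 ltW.
  by apply: mule_ge0 => //; exact: rescaled_density_ge0.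
exists [set y | enorm y = 0]; split.
- rewrite (_ : [set y : Rd | _] = enorm @^-1` [set 0]) // -[X in measurable X]setTI.
  exact: (measurable_enorm _ _ id).
- exact: enorm_eq0_null.
move=> y /= /not_implyP[_ h]; apply: contrapT => y0; apply: h.
rewrite gauss_riesz//; last exact/eqP.
rewrite [RHS]muleCA; congr (_ * _)%E.
by rewrite muleA -EFinM mulVf ?gt_eqF// mul1e.
Qed.

Let I3 b c : \bar R := (\int[mu]_w (heat d w c * half_powR b w)%:E)%E.

(** The measure of the potential term is left open: it is the occupation measure convolved with
    w^(g'-1) dw below the critical exponent, and the occupation measure alone at that exponent. *)
Lemma riesz_balance d2 (X2 : measurableType d2) (mu2 : {measure set X2 -> \bar R})
    S2 rho2 L2 b t (x : Rd) : 0 < b -> 0 < t -> is_laplace mu2 S2 rho2 L2 ->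
  (forall u, 0 < u ->
     exponent t u * (u `^ (- b) * Gamma b) + L2 u = u `^ (- b) * Gamma b) ->
  (I1 b t (enorm x ^+ 2) + \int[mu2]_z (heat d (S2 z) (enorm x ^+ 2) * rho2 z)%:E =
   I3 b (enorm x ^+ 2))%E.
Proof.
move=> b0 t0 H2 HL.
have H3 := is_laplace_half_powR b b0.
have H1 := is_laplace_prod _ _ _ _ _ _ _ _ (is_laplace_rescaled t t0) H3.
apply: (heat_laplace_add _ d_gt0 _ _ _ _ _ _ _ _ _ _ _ _ _ H1 H2 H3) => //.
exact: sqr_ge0.
Qed.

Lemma enorm_powN_riesz (r : R) (x : Rd) : 0 < r -> enorm x != 0 ->
  (enorm_powN x r = ((@riesz_const R d r)^-1)%:E * I3 ((d%:R - r) / 2) (enorm x ^+ 2))%E.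
Proof.
move=> r0 x0; rewrite [I3 _ _](gauss_riesz r x r0 x0) muleA -EFinM.
by rewrite mulVf ?mul1e// gt_eqF// riesz_const_gt0.
Qed.

Let U u : R := u `^ (alpha / 2).

Let U_gt0 u : 0 < u -> 0 < U u. Proof. by move=> u0; rewrite powR_gt0. Qed.

Let integral_occupation t u : 0 < t -> 0 < u ->
  (\int[mu]_s (\1_`]0, t[ s * exponent s u)%:E = ((1 - exponent t u) / U u)%:E)%E.
Proof. by move=> t0 u0; apply: integral_itv_expR => //; exact: U_gt0. Qed.

Let measurable_rescaling d' (T : measurableType d') (f g : T -> R) :
  measurable_fun setT f -> measurable_fun setT g ->
  measurable_fun setT (fun z => f z `^ (2 / alpha) * g z).
Proof.
move=> mf mg; apply: measurable_funM => //.
exact: (measurableT_comp (measurable_powR _)).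
Qed.

(** Integration of e^(-sU) over ]0, t[ gives (1 - e^(-tU)) / U, the transform of the occupation
    measure of the subordinator. The factor [L] is the transform of the measure convolved with
    it. *)
Let is_laplace_occupation d2 (X2 : measurableType d2)
    (m2 : {sigma_finite_measure set X2 -> \bar R}) (S : R -> X2 -> R) (rho : X2 -> R)
    (L : R -> R) (t k : R) :
  0 < t -> 0 <= k ->
  measurable_fun setT (fun z => S z.1 z.2) ->
  measurable_fun setT rho -> (forall x, 0 <= rho x) ->
  (forall s, 0 < s -> is_laplace m2 (S s) rho (fun u => exponent s u * L u)) ->
  is_laplace (prod_measure mu m2) (fun z => S z.1 z.2)
    (fun z => (k * \1_`]0, t[ z.1) * rho z.2)
    (fun u => k * ((1 - exponent t u) / U u) * L u).
Proof.
move=> t0 k0 mS mrho rho0 H.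
apply: (@is_laplace_mix _ _ _ _ _ mu m2 (fun s => k * \1_`]0, t[ s) S rho
  (fun s u => exponent s u * L u)) => //.
- exact: measurable_funM.
- by move=> s; rewrite mulr_ge0.
- move=> s; rewrite mulf_eq0 negb_or indicE => /andP[_].
  case: (boolP (s \in _)) => [|_ /eqP//]; rewrite inE/= in_itv/= => /andP[s0 _] _.
  exact: H.
move=> u u0.
(* Nonnegativity of [L] is read off the transform at time 1, where its other factor is positive. *)
have L0 : 0 <= L u.
  have := laplaceE _ _ _ _ (H 1 ltr01) u u0 => /esym E.
  have : (0 <= (exponent 1 u * L u)%:E)%E.
    rewrite E; apply: integral_ge0 => x _.
    by rewrite lee_fin mulr_ge0 ?expR_ge0.
  by rewrite lee_fin pmulr_rge0// expR_gt0.
transitivity (\int[mu]_s ((k * L u)%:E * (\1_`]0, t[ s * exponent s u)%:E))%E.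
  by apply: eq_integral => s _; rewrite -EFinM; congr EFin; ring.
rewrite ge0_integralZl_EFin ?mulr_ge0//.
- by rewrite integral_occupation// -EFinM; congr EFin; ring.
- by move=> s _; rewrite lee_fin mulr_ge0// expR_ge0.
apply/measurable_EFinP; apply: measurable_funM => //.
apply: measurableT_comp => //; apply: measurable_funN; exact: measurable_funM.
Qed.

Let powRN_half b u : 0 < u -> u `^ (- (b + alpha / 2)) = u `^ (- b) / U u.
Proof. by move=> u0; rewrite opprD powRB// (gt_eqF u0) implybT. Qed.

(* In the critical case the second weight exponent g' vanishes and the mixture
   with w^(g'-1) dw / Gamma(g') degenerates to the point mass at 0. *)
Lemma rescaled_density_le_critical r t (x : Rd) : 0 < r -> r = d%:R - alpha ->
  0 < t -> enorm x != 0 ->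
  (\int[leb]_y (pt t (tsub y x) * enorm_powN y r) <= enorm_powN x r)%E.
Proof.
move=> r0 rE t0 x0; have C0 := @riesz_const_gt0 R d _ r0.
have bE : (d%:R - r) / 2 = alpha / 2 by rewrite rE; congr (_ / _); ring.
have a20 : 0 < alpha / 2 by rewrite divr_gt0.
have G0 := Gamma_gt0 _ a20.
(* Here g = alpha/2, so the target transform is Gamma(alpha/2) / U; this fixes the factor of the
   occupation measure, and [L] is 1. *)
have H2 := @is_laplace_occupation _ _ mu (fun s z => s `^ (2 / alpha) * z) e (fun=> 1)
  t (Gamma (alpha / 2)) t0 (ltW G0).
have {}H2 := H2 (measurable_rescaling _ _ _ _ measurable_fst measurable_snd) me e_ge0.
have Hs s : 0 < s ->
    is_laplace mu (fun z => s `^ (2 / alpha) * z) e (fun u => exponent s u * 1).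
  move=> s0; rewrite (_ : (fun u => _) = exponent s); first exact: is_laplace_rescaled.
  by apply/funext => u; rewrite mulr1.
have {}H2 := H2 Hs.
rewrite rescaled_density_riesz// (enorm_powN_riesz _ _ r0 x0) lee_wpmul2l//.
  by rewrite lee_fin invr_ge0 ltW.
rewrite bE -(riesz_balance _ _ _ _ _ _ _ t x a20 t0 H2).
  rewrite leeDl//; apply: integral_ge0 => z _; rewrite lee_fin mulr_ge0 ?heat_ge0//.
  exact: (laplace_weight_ge0 _ _ _ _ H2).
move=> u u0; rewrite -[alpha / 2]add0r powRN_half// oppr0 powRr0 add0r.
by field; rewrite gt_eqF// U_gt0.
Qed.

(** * The balance equation below the critical exponent *)

Section supermedian.
Variables (r t : R) (x : Rd).
Hypotheses (r0 : 0 < r) (ra : r < d%:R - alpha) (t0 : 0 < t).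

Let b := (d%:R - r) / 2.
Let b' := (d%:R - alpha - r) / 2.

Let b'0 : 0 < b'. Proof. by rewrite divr_gt0// subr_gt0. Qed.
Let bE : b = b' + alpha / 2. Proof. by rewrite /b /b'; field. Qed.
Let b0 : 0 < b. Proof. by rewrite bE addr_gt0// divr_gt0. Qed.

Let k := riesz_rate d alpha r.

Let k0 : 0 < k. Proof. exact: riesz_rate_gt0. Qed.

Let I1_ge0 c s y : (0 <= I1 c s y)%E.
Proof.
apply: integral_ge0 => z _; rewrite lee_fin; apply: mulr_ge0; first exact: heat_ge0.
by apply: mulr_ge0 => //; exact: half_powR_ge0.
Qed.

Lemma enorm_powN_mul (z : Rd) :
  (k%:E * enorm_powN z alpha * enorm_powN z r = k%:E * enorm_powN z (r + alpha))%E.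
Proof.
rewrite /enorm_powN alpha_gt0 r0 addr_gt0//=; case: ifPn => z0.
  by rewrite gt0_muley ?lte_fin// gt0_muley ?ltry// ltry.
by rewrite -muleA -EFinM opprD [in RHS]addrC powRD// z0 implybT.
Qed.

Lemma riesz_supermedian : enorm x != 0 ->
  (\int[leb]_y (pt t (tsub y x) * enorm_powN y r) +
   \int[mu]_(s in `]0%R, t[) \int[leb]_z
     (pt s (tsub z x) * (k%:E * enorm_powN z alpha * enorm_powN z r)) <=
   enorm_powN x r)%E.
Proof.
move=> x0; set c := enorm x ^+ 2.
have ra0 : 0 < r + alpha by rewrite addr_gt0.
have C0 := @riesz_const_gt0 R d _ r0; have Ca0 := @riesz_const_gt0 R d _ ra0.
have [Gb Gb'] := (Gamma_gt0 _ b0, Gamma_gt0 _ b'0).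
(* The factor by which w^(g'-1) dw must be multiplied for the Laplace identity; [inner] shows that
   the coefficient of q yields exactly this factor. *)
pose k' := Gamma b / Gamma b'; have k'0 : 0 < k' by exact: divr_gt0.
have inner s : 0 < s -> (\int[leb]_z
    (pt s (tsub z x) * (k%:E * enorm_powN z alpha * enorm_powN z r)) =
    ((@riesz_const R d r)^-1 * k')%:E * I1 b' s c)%E.
  move=> s0; under eq_integral do rewrite enorm_powN_mul muleCA.
  rewrite ge0_integralZl_EFin ?(ltW k0)//; last 2 first.
  - by move=> z _; rewrite mule_ge0 ?enorm_powN_ge0 ?rescaled_density_ge0.
  - apply: emeasurable_funM; last exact: measurable_enorm_powN.
    by apply: measurable_rescaled_density => //; exact: measurable_tsub.
  rewrite (rescaled_density_riesz _ _ _ ra0 s0) muleA -EFinM.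
  have -> : (d%:R - (r + alpha)) / 2 = b' by rewrite /b' opprD addrA addrAC.
  congr (_ * _)%E; congr EFin.
    rewrite /k /k' /riesz_rate -/b -/b' /riesz_const [2 `^ (_ + _)]powRD; last first.
      by rewrite (gt_eqF ra0).
    have p1 : 0 < (4 * pi : R) `^ (- (d%:R / 2)).
      by rewrite powR_gt0// mulr_gt0// pi_gt0.
    have [p2 p3] : 0 < (2 : R) `^ r /\ 0 < (2 : R) `^ alpha by rewrite !powR_gt0.
    have [g1 g2] : 0 < Gamma (r / 2) /\ 0 < Gamma ((r + alpha) / 2).
      by rewrite !Gamma_gt0 ?divr_gt0.
    exact: (riesz_ratio _ _ _ _ _ _ _ (lt0r_neq0 p1) (lt0r_neq0 p2) (lt0r_neq0 p3)
      (lt0r_neq0 g1) (lt0r_neq0 g2) (lt0r_neq0 Gb')).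
have H2 := @is_laplace_occupation _ _ (prod_measure mu mu)
  (fun s z => s `^ (2 / alpha) * z.1 + z.2) (fun z => e z.1 * half_powR b' z.2)
  (fun u => u `^ (- b') * Gamma b') t k' t0 (ltW k'0).
have mS : measurable_fun setT
    (fun v : R * (R * R) => v.1 `^ (2 / alpha) * v.2.1 + v.2.2).
  apply: measurable_funD.
    apply: measurable_rescaling => //.
    exact: (measurableT_comp measurable_fst measurable_snd).
  exact: (measurableT_comp measurable_snd measurable_snd).
have mrho : measurable_fun setT (fun z : R * R => e z.1 * half_powR b' z.2).
  apply: measurable_funM; first exact: measurableT_comp.
  by apply: measurableT_comp => //; exact: measurable_half_powR.
have rho0 (z : R * R) : 0 <= e z.1 * half_powR b' z.2.
  by apply: mulr_ge0 => //; exact: half_powR_ge0.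
have {}H2 := H2 mS mrho rho0.
have {}H2 := H2 (fun s s0 => is_laplace_prod _ _ _ _ _ _ _ _
  (is_laplace_rescaled s s0) (is_laplace_half_powR b' b'0)).
pose W (v : R * (R * R)) : \bar R := (heat d (v.1 `^ (2 / alpha) * v.2.1 + v.2.2) c *
  (k' * \1_`]0, t[ v.1 * (e v.2.1 * half_powR b' v.2.2)))%:E.
have mW : measurable_fun setT W.
  apply/measurable_EFinP; apply: measurable_funM; first exact: measurable_heat.
  exact: laplace_weight_measurable H2.
have W0 v : (0 <= W v)%E.
  rewrite lee_fin; apply: mulr_ge0; first exact: heat_ge0.
  exact: (laplace_weight_ge0 _ _ _ _ H2).
have B := riesz_balance _ _ _ _ _ _ b t x b0 t0 H2.
rewrite (enorm_powN_riesz _ _ r0 x0) -/b -/c -B; last first.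
  move=> u u0.
  have -> : u `^ (- b) = u `^ (- b') / U u by rewrite bE powRN_half.
  by apply: occupation_balance; rewrite gt_eqF// U_gt0.
rewrite ge0_muleDr//; last by apply: integral_ge0 => z _; exact: W0.
rewrite rescaled_density_riesz// -/b -/c leeD2l//.
rewrite [X in (_ <= _ * X)%E](_ : _ =
  \int[mu]_s \int[prod_measure mu mu]_z W (s, z))%E; last first.
  exact: (@ge0_integral_prod_measure _ _ _ _ _ mu (prod_measure mu mu) W mW W0).
rewrite -ge0_integralZl_EFin ?invr_ge0 ?(ltW C0)//; last 2 first.
- by move=> s _; apply: integral_ge0 => z _; exact: W0.
- exact: (@measurable_fun_fubini_tonelli_F _ _ _ _ _ (prod_measure mu mu) W mW W0).
(* What remains is an equality: for fixed s in ]0, t[ the slice of [W] is the potential term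
   computed by [inner], and outside ]0, t[ it is zero. *)
rewrite le_eqVlt; apply/orP; left; apply/eqP; rewrite [LHS]integral_mkcond.
apply: eq_integral => s _; rewrite /patch.
case: ifPn => st; last first.
  rewrite integral0_eq ?mule0// => z _.
  by rewrite /W /= indicE (negbTE st) mulr0 mul0r mulr0.
have s0 : 0 < s by move: st; rewrite inE/= in_itv/= => /andP[].
rewrite inner// EFinM -muleA; congr (_ * _)%E.
rewrite -ge0_integralZl_EFin ?(ltW k'0)//; last 2 first.
- move=> z _; rewrite lee_fin; apply: mulr_ge0 => //; exact: heat_ge0.
- apply/measurable_EFinP; apply: measurable_funM => //; apply: measurable_heat => //.
  by apply: measurable_funD => //; exact: measurable_funM.
apply: eq_integral => z _; rewrite /W /= indicE st mulr1 -EFinM; congr EFin.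
exact: mulrCA.
Qed.

End supermedian.

End stable.

Theorem corollary6 (R : realType) (d : nat) (alpha : R) (eta : R -> R -> R)
    (d_gt0 : (0 < d)%N) (alpha_gt0 : 0 < alpha) (alpha_lt2 : alpha < 2)
    (eta_density : forall t : R, 0 < t ->
      is_stable_subordinator_density alpha t (eta t)) :
  let Rd := d.-tuple (measurableTypeR R) in
  let p : R -> Rd -> \bar R := subordinated_density eta in
  (forall (r : R) (x : Rd) (t : R),
     0 <= r -> r <= d%:R - alpha -> 0 < t ->
     (\int[lebesgue_tuple]_y (p t (tsub y x) * enorm_powN y r)
        <= enorm_powN x r)%E)
  /\
  (forall (r : R) (x : Rd) (t : R),
     0 < r -> r < d%:R - alpha -> 0 < t ->
     let beta := (d%:R - alpha - r) / alpha in
     let q : Rd -> \bar R := fun z =>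
       ((2 `^ alpha * Gamma (d%:R / 2 - alpha * beta / 2)
           * Gamma (alpha * (beta + 1) / 2)
         / (Gamma (d%:R / 2 - alpha * (beta + 1) / 2)
            * Gamma (alpha * beta / 2)))%:E * enorm_powN z alpha)%E in
     let ptilde := schrodinger_perturbation (transition_density p) q in
     (\int[lebesgue_tuple]_y (ptilde t x y * enorm_powN y r)
        <= enorm_powN x r)%E).
Proof.
move=> Rd p; pose pt := @rescaled_density R d alpha (eta 1).
have ppt t x : 0 < t -> p t x = pt t x.
  by move=> t0; exact: (subordinated_rescaled alpha eta d_gt0 alpha_gt0 eta_density).
have pt0 t x : (0 <= pt t x)%E by exact: (rescaled_density_ge0 alpha eta eta_density).
have at0 r (x : Rd) : 0 < r -> enorm x = 0 -> enorm_powN x r = +oo%E.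
  by move=> r0 x0; rewrite /enorm_powN r0 x0 eqxx.
split=> r x t.
  move=> r0 rle t0; under eq_integral do rewrite ppt//.
  (* For r = 0 the mixture with weight w^(d/2 - 1) diverges at infinity, but the claim reduces to
     total mass 1. *)
  move: r0; rewrite le_eqVlt => /predU1P[<-|r0].
    have one (y : Rd) : enorm_powN y 0 = 1%E.
      by rewrite /enorm_powN ltxx/= oppr0 powRr0.
    rewrite one; under eq_integral do rewrite one mule1.
    by rewrite (rescaled_density_mass alpha eta alpha_gt0 eta_density).
  have [x0|x0] := eqVneq (enorm x) 0; first by rewrite at0// leey.
  move: rle; rewrite le_eqVlt => /predU1P[rE|rlt].
    exact: (rescaled_density_le_critical alpha eta d_gt0 alpha_gt0 eta_density r t x r0 rE t0 x0).
  (* Below the critical exponent the nonnegative potential term of the balance is dropped. *)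
  apply: le_trans (riesz_supermedian alpha eta d_gt0 alpha_gt0 eta_density r t x r0 rlt t0 x0).
  rewrite leeDl//; apply: integral_ge0 => s _; apply: integral_ge0 => z _.
  rewrite mule_ge0// mule_ge0 ?enorm_powN_ge0// mule_ge0 ?enorm_powN_ge0//.
  by rewrite lee_fin ltW// riesz_rate_gt0.
move=> r0 rlt t0; cbv zeta.
pose P t (x y : Rd) := pt t (tsub y x).
pose k := riesz_rate d alpha r.
set beta := (d%:R - alpha - r) / alpha.
(* Thus alpha beta / 2 = g' and alpha (beta + 1) / 2 = g, which turns the coefficient of q into
   [riesz_rate]. *)
have abE : alpha * beta = d%:R - alpha - r by rewrite mulrC divfK// gt_eqF.
have -> : 2 `^ alpha * Gamma (d%:R / 2 - alpha * beta / 2) *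
    Gamma (alpha * (beta + 1) / 2) /
    (Gamma (d%:R / 2 - alpha * (beta + 1) / 2) * Gamma (alpha * beta / 2)) = k.
  rewrite /k /riesz_rate mulrDr mulr1 abE.
  have -> : d%:R / 2 - (d%:R - alpha - r) / 2 = (r + alpha) / 2 by field.
  have -> : d%:R - alpha - r + alpha = d%:R - r by ring.
  by have -> : d%:R / 2 - (d%:R - r) / 2 = r / 2 by field.
pose q (z : Rd) := (k%:E * enorm_powN z alpha)%E.
have k0 : 0 < k by exact: riesz_rate_gt0.
have -> : (fun y : Rd => schrodinger_perturbation (transition_density p) q t x y *
    enorm_powN y r)%E = (fun y => schrodinger_perturbation P q t x y * enorm_powN y r)%E.
  apply/funext => y; congr (_ * _)%E; apply: eq_eseriesr => n _.
  by apply: eq_perturbation_term => // s u v s0; rewrite /transition_density ppt.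
have q0 z : (0 <= q z)%E by rewrite mule_ge0 ?enorm_powN_ge0// lee_fin ltW.
apply: (schrodinger_perturbation_le P q (enorm_powN^~ r)) => //.
- by move=> s u v; exact: pt0.
- by move=> z; exact: enorm_powN_ge0.
- apply: (measurable_rescaled_density alpha eta eta_density).
    exact: (measurableT_comp measurable_fst measurable_fst).
  apply: measurable_tsub => //.
  exact: (measurableT_comp measurable_snd measurable_fst).
- by apply: emeasurable_funM => //; exact: (measurable_enorm_powN _ _ _ id).
- exact: (measurable_enorm_powN _ _ _ id).
(* The hypothesis on h concerns all points; at the origin its right side is +oo. *)
move=> {t0}t {}x t0; have [x0|x0] := eqVneq (enorm x) 0; first by rewrite at0// leey.
exact: (riesz_supermedian alpha eta d_gt0 alpha_gt0 eta_density r t x r0 rlt t0 x0).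
Qed.
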